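(* Let $(R,\mathfrak m,k)$ be a local ring such that $\mathfrak m$ has a Conca generator, and set $\mathcal E=\operatorname{Ext}_R(k,k)$. For every finite $R$-module $L$ the graded $\mathcal E$-module $\operatorname{Ext}_R(L,k)$ has a finite free resolution of length at most $2$, that is, a resolution of length at most $2$ by finite free graded $\mathcal E$-modules.
   Context: A local ring $(R,\mathfrak m,k)$ is a commutative Noetherian ring $R$ with unique maximal ideal $\mathfrak m$ and residue field $k=R/\mathfrak m$. ''Finite'' means finitely generated. Conca generator: an element $x$ is a Conca generator of an ideal $J$ if $x\in J$, $x\neq0=x^2$ and $xJ=J^2$. With $F$ a free resolution of $L$ and $G$ one of $k$ over $R$, composition makes $\mathcal E=\operatorname{Ext}_R(k,k)=\operatorname H(\operatorname{Hom}_R(G,G))$ a graded $k$-algebra and $\operatorname{Ext}_R(L,k)=\operatorname H(\operatorname{Hom}_R(F,G))$ a graded left $\mathcal E$-module. *)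

(* Defs.v *)
From HB Require Import structures.
From mathcomp Require Import all_boot all_algebra.
From mathcomp Require Import boolp classical_sets.

Set Implicit Arguments.
Unset Strict Implicit.
Unset Printing Implicit Defensive.

Import GRing.Theory.
Local Open Scope ring_scope.
Local Open Scope classical_set_scope.

Section Ideals.
Variable R : comNzRingType.
Implicit Types (I J m : set R) (x : R).

Definition ideal I : Prop :=
  [/\ I 0, forall a b, I a -> I b -> I (a + b) & forall r a, I a -> I (r * a)].

Definition fg_ideal I : Prop :=
  exists (n : nat) (g : 'I_n -> R),
    forall x, I x <-> exists c : 'I_n -> R, x = \sum_(i < n) c i * g i.

Definition noetherian : Prop := forall I, ideal I -> fg_ideal I.

Definition maximal_ideal m : Prop :=
  [/\ ideal m, ~ m 1 &
      forall J, ideal J -> m `<=` J -> J = m \/ J = [set: R]].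

Definition ideal_mul I J : set R :=
  [set x | exists (n : nat) (a b : 'I_n -> R),
     (forall i, I (a i) /\ J (b i)) /\ x = \sum_(i < n) a i * b i].

Definition conca_generator J x : Prop :=
  [/\ J x, x != 0, x ^+ 2 = 0 & [set x * y | y in J] = ideal_mul J J].

(* The residue field of (R, m, k) is presented as a field k together with a
   surjective ring morphism R -> k of kernel m. *)
Definition local_ring m (k : fieldType) (pi : {rmorphism R -> k}) : Prop :=
  [/\ noetherian, maximal_ideal m, forall m', maximal_ideal m' -> m' = m,
      forall y : k, exists r : R, pi r = y & forall r : R, pi r = 0 <-> m r].

End Ideals.

Definition resmod (R : comNzRingType) (k : fieldType)
  (pi : {rmorphism R -> k}) : Type := k.

Section ResMod.
Variables (R : comNzRingType) (k : fieldType) (pi : {rmorphism R -> k}).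

HB.instance Definition _ := GRing.Zmodule.on (resmod pi).

Definition resmod_scale (r : R) (y : resmod pi) : resmod pi := pi r * (y : k).

Fact resmod_scaleA a b v :
  resmod_scale a (resmod_scale b v) = resmod_scale (a * b) v.
Proof. by rewrite /resmod_scale rmorphM mulrA. Qed.
Fact resmod_scale1 : left_id 1 resmod_scale.
Proof. by move=> v; rewrite /resmod_scale rmorph1 mul1r. Qed.
Fact resmod_scaleDr : right_distributive resmod_scale +%R.
Proof. by move=> a u v; rewrite /resmod_scale mulrDr. Qed.
Fact resmod_scaleDl v : {morph resmod_scale^~ v : a b / a + b}.
Proof. by move=> a b; rewrite /resmod_scale rmorphD mulrDl. Qed.

HB.instance Definition _ := GRing.Zmodule_isLmodule.Build R (resmod pi)
  resmod_scaleA resmod_scale1 resmod_scaleDr resmod_scaleDl.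
End ResMod.

Section Modules.
Variables (R : comNzRingType) (M : lmodType R).

Definition finite_module : Prop :=
  exists (n : nat) (b : 'I_n -> M),
    forall x : M, exists c : 'I_n -> R, x = \sum_(i < n) c i *: b i.

Definition basis (B : set M) : Prop :=
  (forall x : M, exists (s : seq M) (c : M -> R),
     (forall b, b \in s -> B b) /\ x = \sum_(b <- s) c b *: b) /\
  (forall (s : seq M) (c : M -> R), uniq s -> (forall b, b \in s -> B b) ->
     \sum_(b <- s) c b *: b = 0 -> forall b, b \in s -> c b = 0).

Definition free_module : Prop := exists B : set M, basis B.

End Modules.

(* Homology of U --f--> V --g--> W at V, that is, ker g / (im f `&` ker g);
   g \o f = 0 is not assumed. *)
Section Homology.
Variables (R : comNzRingType) (U V W : lmodType R).
Variables (f : {linear U -> V}) (g : {linear V -> W}).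

Definition cycle_pred : {pred V} := fun v => g v == 0.

Fact cycle_closed : submod_closed cycle_pred.
Proof.
split; first by rewrite unfold_in linear0.
move=> a u v; rewrite !unfold_in => /eqP gu /eqP gv.
by rewrite linearP gu gv scaler0 addr0.
Qed.
HB.instance Definition _ := GRing.isSubmodClosed.Build R V cycle_pred
  cycle_closed.

Record cycle := Cycle { cycle_val : V; _ : cycle_val \in cycle_pred }.
HB.instance Definition _ := [isSub for cycle_val].
HB.instance Definition _ := [Choice of cycle by <:].
HB.instance Definition _ := [SubChoice_isSubLmodule of cycle by <:].

Lemma cycle_valZ a z : cycle_val (a *: z) = a *: cycle_val z.
Proof. exact: (linearZZ (\val : cycle -> V)). Qed.

Definition boundary : {pred cycle} :=
  fun z => `[< exists u : U, f u = cycle_val z >].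

Fact boundary_closed : submod_closed boundary.
Proof.
split; first by apply/asboolP; exists 0; rewrite linear0.
move=> a z1 z2 /asboolP[u1 e1] /asboolP[u2 e2]; apply/asboolP.
by exists (a *: u1 + u2); rewrite linearP e1 e2.
Qed.
HB.instance Definition _ := GRing.isSubmodClosed.Build R cycle boundary
  boundary_closed.

Definition homology : Type := Quotient.quot boundary.
HB.instance Definition _ := GRing.Zmodule.on homology.

Definition hclass (z : cycle) : homology := \pi_(Quotient.quot boundary)%qT z.
Definition hrepr (x : homology) : cycle := repr (x : Quotient.quot boundary).

Lemma hreprK x : hclass (hrepr x) = x.
Proof. exact: reprK. Qed.

Lemma hclassP z1 z2 :
  hclass z1 = hclass z2 <->
  exists u : U, f u = cycle_val z1 - cycle_val z2.
Proof.
split=> [/eqP|[u e]].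
  by rewrite -Quotient.idealrBE => /asboolP.
by apply/eqP; rewrite -Quotient.idealrBE; apply/asboolP; exists u.
Qed.

Fact hclass_is_zmod_morphism : zmod_morphism hclass.
Proof. by move=> x y; rewrite /hclass !piE. Qed.
HB.instance Definition _ := GRing.isZmodMorphism.Build cycle homology hclass
  hclass_is_zmod_morphism.

Definition homology_scale (a : R) (x : homology) : homology :=
  hclass (a *: hrepr x).

Lemma homology_scaleE a z : homology_scale a (hclass z) = hclass (a *: z).
Proof.
have /hclassP[u e] := hreprK (hclass z).
by apply/hclassP; exists (a *: u); rewrite !cycle_valZ -scalerBr -e linearZ_LR.
Qed.

Fact homology_scaleA a b v :
  homology_scale a (homology_scale b v) = homology_scale (a * b) v.
Proof. by rewrite -(hreprK v) !homology_scaleE scalerA. Qed.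
Fact homology_scale1 : left_id 1 homology_scale.
Proof. by move=> v; rewrite -(hreprK v) homology_scaleE scale1r. Qed.
Fact homology_scaleDr : right_distributive homology_scale +%R.
Proof.
move=> a u v; rewrite -(hreprK u) -(hreprK v) -raddfD !homology_scaleE.
by rewrite scalerDr raddfD.
Qed.
Fact homology_scaleDl v : {morph homology_scale^~ v : a b / a + b}.
Proof. by move=> a b; rewrite -(hreprK v) !homology_scaleE scalerDl raddfD. Qed.

HB.instance Definition _ := GRing.Zmodule_isLmodule.Build R homology
  homology_scaleA homology_scale1 homology_scaleDr homology_scaleDl.

Fact hclass_is_scalable : scalable hclass.
Proof. by move=> a z; rewrite -homology_scaleE. Qed.
HB.instance Definition _ := GRing.isScalable.Build R cycle homology _ hclass
  hclass_is_scalable.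

End Homology.

(* Modules are graded homologically by int.  A homogeneous map of
   (cohomological) degree n sends F i to G (i - n); it is stored as a matrix of
   components F i -> G j that vanish unless i = j + n, so that composition
   needs no transport between G (i - (m + n)) and G (i - n - m). *)
Record ghom (R : comNzRingType) (F G : int -> lmodType R) (n : int) := GHom {
  ghom_fun : forall i j, F i -> G j;
  ghom_linear : forall i j, linear (@ghom_fun i j);
  ghom_degree : forall i j x, i != j + n -> @ghom_fun i j x = 0 }.

Section GHom.
Variables (R : comNzRingType) (F G : int -> lmodType R) (n : int).
Local Notation ghom := (ghom F G n).

Definition ghom_app (f : ghom) i j : F i -> G j := @ghom_fun R F G n f i j.

HB.instance Definition _ (f : ghom) i j :=
  GRing.isLinear.Build R (F i) (G j) _ (@ghom_app f i j)
    (@ghom_linear R F G n f i j).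

Lemma ghom_app0 (f : ghom) i j (x : F i) : i != j + n -> ghom_app f j x = 0.
Proof. exact: ghom_degree. Qed.

Lemma ghomP (f g : ghom) :
  (forall i j (x : F i), ghom_app f j x = ghom_app g j x) -> f = g.
Proof.
case: f g => [f fl fd] [g gl gd] /= e.
have {}e : f = g.
  by apply: functional_extensionality_dep => i;
     apply: functional_extensionality_dep => j; apply/funext => x; apply: e.
by case: _ / e gl gd => gl gd; congr GHom; apply: Prop_irrelevance.
Qed.

HB.instance Definition _ := gen_eqMixin ghom.
HB.instance Definition _ := gen_choiceMixin ghom.

Definition ghom_zero : ghom.
Proof.
by exists (fun _ _ _ => 0) => // i j a x y; rewrite scaler0 addr0.
Defined.

Definition ghom_opp (f : ghom) : ghom.
Proof.
exists (fun i j x => - ghom_app f j x) => [i j a x y|i j x /ghom_app0->].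
  by rewrite linearP opprD scalerN.
by rewrite oppr0.
Defined.

Definition ghom_add (f g : ghom) : ghom.
Proof.
exists (fun i j x => ghom_app f j x + ghom_app g j x) => [i j a x y|i j x ne].
  by rewrite !linearP scalerDr addrACA.
by rewrite !ghom_app0 // addr0.
Defined.

Definition ghom_scale (r : R) (f : ghom) : ghom.
Proof.
exists (fun i j x => r *: ghom_app f j x) => [i j a x y|i j x /ghom_app0->].
  by rewrite linearP scalerDr !scalerA mulrC.
by rewrite scaler0.
Defined.

Fact ghom_addA : associative ghom_add.
Proof. by move=> f g h; apply: ghomP => i j x; apply: addrA. Qed.
Fact ghom_addC : commutative ghom_add.
Proof. by move=> f g; apply: ghomP => i j x; apply: addrC. Qed.
Fact ghom_add0 : left_id ghom_zero ghom_add.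
Proof. by move=> f; apply: ghomP => i j x; apply: add0r. Qed.
Fact ghom_addN : left_inverse ghom_zero ghom_opp ghom_add.
Proof. by move=> f; apply: ghomP => i j x; apply: addNr. Qed.
HB.instance Definition _ := GRing.isZmodule.Build ghom
  ghom_addA ghom_addC ghom_add0 ghom_addN.

Fact ghom_scaleA a b f : ghom_scale a (ghom_scale b f) = ghom_scale (a * b) f.
Proof. by apply: ghomP => i j x; apply: scalerA. Qed.
Fact ghom_scale1 : left_id 1 ghom_scale.
Proof. by move=> f; apply: ghomP => i j x; apply: scale1r. Qed.
Fact ghom_scaleDr : right_distributive ghom_scale +%R.
Proof. by move=> a f g; apply: ghomP => i j x; apply: scalerDr. Qed.
Fact ghom_scaleDl f : {morph ghom_scale^~ f : a b / a + b}.
Proof. by move=> a b; apply: ghomP => i j x; apply: scalerDl. Qed.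
HB.instance Definition _ := GRing.Zmodule_isLmodule.Build R ghom
  ghom_scaleA ghom_scale1 ghom_scaleDr ghom_scaleDl.

Lemma ghom_appD (f g : ghom) i j (x : F i) :
  ghom_app (f + g) j x = ghom_app f j x + ghom_app g j x.
Proof. by []. Qed.
Lemma ghom_appN (f : ghom) i j (x : F i) : ghom_app (- f) j x = - ghom_app f j x.
Proof. by []. Qed.
Lemma ghom_appZ a (f : ghom) i j (x : F i) :
  ghom_app (a *: f) j x = a *: ghom_app f j x.
Proof. by []. Qed.

End GHom.

Section Composition.
Variable R : comNzRingType.
Implicit Types F G H K : int -> lmodType R.

Definition ghom_id F : ghom F F 0.
Proof.
exists (fun i j x => if @eqP _ i j is ReflectT e then eq_rect i F x j e else 0).
  move=> i j a x y; case: eqP => [e|_]; last by rewrite scaler0 addr0.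
  by case: _ / e.
by move=> i j x; rewrite addr0; case: eqP.
Defined.

Definition ghom_comp F G H m n p (e : m + n = p)
  (g : ghom G H m) (f : ghom F G n) : ghom F H p.
Proof.
exists (fun i l x => ghom_app g l (ghom_app f (i - n) x)).
  by move=> i j a x y; rewrite !linearP.
move=> i j x ne; rewrite ghom_app0 //.
by apply: contraNneq ne => h; rewrite -e addrA -h subrK.
Defined.

Lemma ghom_compE F G H m n p (e : m + n = p) (g : ghom G H m) (f : ghom F G n)
    i j l (x : F i) : i = j + n ->
  ghom_app (ghom_comp e g f) l x = ghom_app g l (ghom_app f j x).
Proof.
by move=> e'; have -> : j = i - n by rewrite e' addrK.
Qed.

Lemma ghom_idE F i x : ghom_app (ghom_id F) i x = x.
Proof.
by rewrite /ghom_app /=; case: eqP => // e; rewrite (Prop_irrelevance e erefl).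
Qed.

Lemma ghom_compA F G H K l m n lm mn p (e1 : l + m = lm) (e2 : lm + n = p)
    (e3 : m + n = mn) (e4 : l + mn = p)
    (h : ghom H K l) (g : ghom G H m) (f : ghom F G n) :
  ghom_comp e2 (ghom_comp e1 h g) f = ghom_comp e4 h (ghom_comp e3 g f).
Proof.
apply: ghomP => i j x.
rewrite (ghom_compE _ _ _ _ _ (esym (subrK n i))) //.
rewrite (ghom_compE _ _ _ _ _ (esym (subrK m (i - n)))) //.
rewrite (@ghom_compE _ _ _ _ _ _ e4 _ _ i (i - n - m)); last first.
  by rewrite -e3 addrA subrK subrK.
by rewrite (ghom_compE _ _ _ _ _ (esym (subrK n i))).
Qed.

Lemma ghom_comp1l F G n (e : 0 + n = n) (f : ghom F G n) :
  ghom_comp e (ghom_id G) f = f.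
Proof.
apply: ghomP => i j x; have [h|h] := eqVneq i (j + n).
  by rewrite (ghom_compE _ _ _ _ _ h) ghom_idE.
by rewrite !ghom_app0.
Qed.

Lemma ghom_comp1r F G n (e : n + 0 = n) (f : ghom F G n) :
  ghom_comp e f (ghom_id F) = f.
Proof.
apply: ghomP => i j x.
by rewrite (ghom_compE _ _ _ _ _ (esym (addr0 i))) ghom_idE.
Qed.

Lemma ghom_compPl F G H m n p (e : m + n = p) (f : ghom F G n) :
  linear (fun g : ghom G H m => ghom_comp e g f).
Proof. by move=> a g g'; apply: ghomP. Qed.

Lemma ghom_compPr F G H m n p (e : m + n = p) (g : ghom G H m) :
  linear (fun f : ghom F G n => ghom_comp e g f).
Proof.
move=> a f f'; apply: ghomP => i j x.
rewrite ghom_appD ghom_appZ !(ghom_compE _ _ _ _ _ (esym (subrK n i))).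
by rewrite ghom_appD ghom_appZ linearP.
Qed.

Lemma ghom_comp0l F G H m n p (e : m + n = p) (f : ghom F G n) :
  ghom_comp e (0 : ghom G H m) f = 0.
Proof. exact: ghomP. Qed.

Lemma ghom_compBl F G H m n p (e : m + n = p) (g g' : ghom G H m)
    (f : ghom F G n) :
  ghom_comp e (g - g') f = ghom_comp e g f - ghom_comp e g' f.
Proof. exact: ghomP. Qed.

Lemma ghom_compZl F G H m n p (e : m + n = p) a (g : ghom G H m)
    (f : ghom F G n) : ghom_comp e (a *: g) f = a *: ghom_comp e g f.
Proof. exact: ghomP. Qed.

Lemma ghom_comp0r F G H m n p (e : m + n = p) (g : ghom G H m) :
  ghom_comp e g (0 : ghom F G n) = 0.
Proof.
by have := ghom_compPr e g (-1) 0 (0 : ghom F G n); rewrite !scaleN1r !addNr.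
Qed.

Lemma ghom_compZr F G H m n p (e : m + n = p) a (g : ghom G H m)
    (f : ghom F G n) : ghom_comp e g (a *: f) = a *: ghom_comp e g f.
Proof.
by have := ghom_compPr e g a f 0; rewrite ghom_comp0r !addr0.
Qed.

Lemma ghom_compBr F G H m n p (e : m + n = p) (g : ghom G H m)
    (f f' : ghom F G n) :
  ghom_comp e g (f - f') = ghom_comp e g f - ghom_comp e g f'.
Proof.
by rewrite addrC -scaleN1r ghom_compPr scaleN1r addrC.
Qed.

End Composition.


Record chain_complex (R : comNzRingType) := ChainComplex {
  cplx_sort :> int -> lmodType R;
  cplx_d : ghom cplx_sort cplx_sort 1;
  cplx_dd : ghom_comp erefl cplx_d cplx_d = 0 :> ghom _ _ (1 + 1) }.

Lemma signzD (R : comNzRingType) (m n : int) :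
  (-1) ^+ absz (m + n) = (-1) ^+ absz m * (-1) ^+ absz n :> R.
Proof.
have sgE (l : int) : (-1) ^+ absz l = (((-1) ^ l : int)%:~R : R).
  have -> : ((-1) ^ l : int) = (-1) ^+ absz l.
    by case: l => // l; rewrite NegzE abszN absz_nat -exprnN invr_sign.
  by rewrite rmorphXn /= rmorphN1.
by rewrite !sgE -rmorphM /= -exprzDr // unitrN1.
Qed.

Section HomComplex.
Variable R : comNzRingType.
Implicit Types F G H K : chain_complex R.

Definition hom_d F G n p (e : n + 1 = p) (f : ghom F G n) : ghom F G p :=
  ghom_comp (etrans (addrC 1 n) e) (cplx_d G) f
    - (-1) ^+ absz n *: ghom_comp e f (cplx_d F).

Fact hom_d_is_linear F G n p (e : n + 1 = p) : linear (@hom_d F G n p e).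
Proof.
move=> a f g; rewrite /hom_d ghom_compPl ghom_compPr.
rewrite scalerBr scalerDr !scalerA [_ * a]mulrC opprD.
by rewrite addrACA.
Qed.
HB.instance Definition _ F G n p (e : n + 1 = p) :=
  GRing.isLinear.Build R (ghom F G n) (ghom F G p) _ (hom_d e)
    (@hom_d_is_linear F G n p e).

Lemma hom_d_comp F G H m n p m' n' p' (e : m + n = p) (em : m + 1 = m')
    (en : n + 1 = n') (ep : p + 1 = p') (e1 : m' + n = p') (e2 : m + n' = p')
    (g : ghom G H m) (f : ghom F G n) :
  hom_d ep (ghom_comp e g f) =
    ghom_comp e1 (hom_d em g) f
      + (-1) ^+ absz m *: ghom_comp e2 g (hom_d en f).
Proof.
rewrite /hom_d ghom_compBl ghom_compZl ghom_compBr ghom_compZr scalerBr.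
rewrite scalerA -(signzD R m n) e.
rewrite (ghom_compA _ _ (etrans (addrC 1 n) en) e2).
rewrite (ghom_compA _ _ e (etrans (addrC 1 p) ep)).
rewrite (ghom_compA e ep en e2).
by rewrite addrA subrK.
Qed.

Definition HomH F G (n : int) : lmodType R :=
  homology (@hom_d F G (n - 1) n (subrK 1 n)) (@hom_d F G n (n + 1) erefl).

Definition cocycle F G (n : int) : Type :=
  cycle (@hom_d F G n (n + 1) erefl).

Definition HomH_class F G n (z : cocycle F G n) : HomH F G n := hclass _ z.
Definition HomH_repr F G n (x : HomH F G n) : cocycle F G n := hrepr x.

Lemma cocycleP F G n n' (e : n + 1 = n') (z : cocycle F G n) :
  hom_d e (cycle_val z) = 0.
Proof. by case: _ / e; case: z => z /= /eqP. Qed.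

Definition cocycle_comp F G H m n p (e : m + n = p)
  (z : cocycle G H m) (w : cocycle F G n) : cocycle F H p.
Proof.
exists (ghom_comp e (cycle_val z) (cycle_val w)); apply/eqP.
have e1 : (m + 1) + n = p + 1 by rewrite -e addrAC.
have e2 : m + (n + 1) = p + 1 by rewrite -e addrA.
rewrite /= (hom_d_comp e erefl erefl erefl e1 e2) !cocycleP.
by rewrite ghom_comp0l ghom_comp0r scaler0 addr0.
Defined.

Definition HomH_mul F G H m n p (e : m + n = p)
    (x : HomH G H m) (y : HomH F G n) : HomH F H p :=
  HomH_class (cocycle_comp e (HomH_repr x) (HomH_repr y)).

Lemma HomH_mulE F G H m n p (e : m + n = p)
    (z : cocycle G H m) (w : cocycle F G n) :
  HomH_mul e (HomH_class z) (HomH_class w) = HomH_class (cocycle_comp e z w).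
Proof.
rewrite /HomH_mul; set z' := HomH_repr _; set w' := HomH_repr _.
have /hclassP[u eu] : HomH_class z' = HomH_class z by exact: hreprK.
have /hclassP[v ev] : HomH_class w' = HomH_class w by exact: hreprK.
have e1 : (m - 1) + n = p - 1 by rewrite -e addrAC.
have e2 : m + (n - 1) = p - 1 by rewrite -e addrA.
apply/hclassP => /=.
exists (ghom_comp e1 u (cycle_val w')
          + (-1) ^+ absz m *: ghom_comp e2 (cycle_val z) v).
have e3 : (m - 1) + (n + 1) = p by rewrite addrACA addNr addr0.
have e4 : (m + 1) + (n - 1) = p by rewrite addrACA subrr addr0.
rewrite linearD linearZ_LR /=.
rewrite (hom_d_comp e1 (subrK 1 m) erefl (subrK 1 p) e e3).
rewrite (hom_d_comp e2 erefl (subrK 1 n) (subrK 1 p) e4 e).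
rewrite !cocycleP eu ev ghom_comp0l ghom_comp0r scaler0 addr0 add0r.
rewrite scalerA -expr2 sqrr_sign scale1r ghom_compBl ghom_compBr.
by rewrite addrA subrK.
Qed.

Lemma HomH_classK F G n (x : HomH F G n) : HomH_class (HomH_repr x) = x.
Proof. exact: hreprK. Qed.

Lemma HomH_classP F G n a (z w : cocycle F G n) :
  HomH_class (a *: z + w) = a *: HomH_class z + HomH_class w.
Proof. exact: linearP. Qed.

Lemma cocycle_inj F G n (z w : cocycle F G n) :
  cycle_val z = cycle_val w -> z = w.
Proof. exact: val_inj. Qed.

Fact HomH_mul_linearl F G H m n p (e : m + n = p) (y : HomH F G n) :
  linear (fun x : HomH G H m => HomH_mul e x y).
Proof.
move=> a x x'; rewrite -(HomH_classK x) -(HomH_classK x') -(HomH_classK y).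
rewrite -HomH_classP !HomH_mulE -HomH_classP; congr HomH_class.
by apply: cocycle_inj; apply: ghom_compPl.
Qed.

Fact HomH_mul_linearr F G H m n p (e : m + n = p) (x : HomH G H m) :
  linear (fun y : HomH F G n => HomH_mul e x y).
Proof.
move=> a y y'; rewrite -(HomH_classK x) -(HomH_classK y') -(HomH_classK y).
rewrite -HomH_classP !HomH_mulE -HomH_classP; congr HomH_class.
by apply: cocycle_inj; apply: ghom_compPr.
Qed.

Fact HomH_mulA F G H K l m n lm mn p (e1 : l + m = lm) (e2 : lm + n = p)
    (e3 : m + n = mn) (e4 : l + mn = p)
    (x : HomH H K l) (y : HomH G H m) (z : HomH F G n) :
  HomH_mul e2 (HomH_mul e1 x y) z = HomH_mul e4 x (HomH_mul e3 y z).
Proof.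
rewrite -(HomH_classK x) -(HomH_classK y) -(HomH_classK z) !HomH_mulE.
by congr HomH_class; apply: cocycle_inj; apply: ghom_compA.
Qed.

Definition cocycle_id F : cocycle F F 0.
Proof.
exists (ghom_id F); apply/eqP; rewrite /= /hom_d expr0 scale1r.
apply: ghomP => i j x.
rewrite ghom_appD ghom_appN (ghom_compE _ _ _ _ _ (esym (addr0 i))) ghom_idE.
have [h|h] := eqVneq i (j + 1).
  by rewrite (ghom_compE _ _ _ _ _ h) ghom_idE subrr.
by rewrite !(ghom_app0 _ _ h) subr0.
Defined.

Definition HomH_one F : HomH F F 0 := HomH_class (cocycle_id F).

Fact HomH_mul1l F G n (e : 0 + n = n) (x : HomH F G n) :
  HomH_mul e (HomH_one G) x = x.
Proof.
rewrite -(HomH_classK x) HomH_mulE; congr HomH_class.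
by apply: cocycle_inj; apply: ghom_comp1l.
Qed.

Fact HomH_mul1r F G n (e : n + 0 = n) (x : HomH F G n) :
  HomH_mul e x (HomH_one F) = x.
Proof.
rewrite -(HomH_classK x) HomH_mulE; congr HomH_class.
by apply: cocycle_inj; apply: ghom_comp1r.
Qed.

End HomComplex.

(* The product A_m x A_n -> A_p is indexed by a proof of m + n = p, so that
   associativity and unitality typecheck without transport. *)
Record graded_algebra (R : comNzRingType) := GradedAlgebra {
  galg_sort :> int -> lmodType R;
  galg_one : galg_sort 0;
  galg_mul : forall m n p, m + n = p ->
    galg_sort m -> galg_sort n -> galg_sort p;
  galg_mul_linearl : forall m n p (e : m + n = p) b,
    linear (fun a => galg_mul e a b);
  galg_mul_linearr : forall m n p (e : m + n = p) a,
    linear (fun b => galg_mul e a b);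
  galg_mulA : forall l m n lm mn p (e1 : l + m = lm) (e2 : lm + n = p)
    (e3 : m + n = mn) (e4 : l + mn = p) a b c,
    galg_mul e2 (galg_mul e1 a b) c = galg_mul e4 a (galg_mul e3 b c);
  galg_mul1l : forall n (e : 0 + n = n) a, galg_mul e galg_one a = a;
  galg_mul1r : forall n (e : n + 0 = n) a, galg_mul e a galg_one = a }.

Record graded_module (R : comNzRingType) (A : graded_algebra R) :=
  GradedModule {
  gmod_sort :> int -> lmodType R;
  gmod_act : forall m n p, m + n = p -> A m -> gmod_sort n -> gmod_sort p;
  gmod_act_linearl : forall m n p (e : m + n = p) x,
    linear (fun a => gmod_act e a x);
  gmod_act_linearr : forall m n p (e : m + n = p) a,
    linear (fun x => gmod_act e a x);
  gmod_actA : forall l m n lm mn p (e1 : l + m = lm) (e2 : lm + n = p)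
    (e3 : m + n = mn) (e4 : l + mn = p) a b x,
    gmod_act e2 (galg_mul e1 a b) x = gmod_act e4 a (gmod_act e3 b x);
  gmod_act1 : forall n (e : 0 + n = n) x, gmod_act e (galg_one A) x = x }.

Record graded_hom (R : comNzRingType) (A : graded_algebra R)
    (M N : graded_module A) := GradedHom {
  ghm_fun :> forall n, M n -> N n;
  ghm_linear : forall n, linear (@ghm_fun n);
  ghm_act : forall m n p (e : m + n = p) (a : A m) (x : M n),
    ghm_fun (gmod_act e a x) = gmod_act e a (ghm_fun x) }.

Section GradedFreeResolutions.
Variables (R : comNzRingType) (A : graded_algebra R).

(* M has a finite basis b_0, ..., b_(r-1) of homogeneous elements; d s is the
   degree of b_s. *)
Definition finite_free (M : graded_module A) : Prop :=
  exists (r : nat) (d : 'I_r -> int) (b : forall s, M (d s)),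
    forall n (x : M n), exists! a : forall s, A (n - d s),
      x = \sum_(s < r) gmod_act (subrK (d s) n) (a s) (b s).

Definition has_finite_free_resolution (M : graded_module A) (l : nat) : Prop :=
  exists (P : nat -> graded_module A)
    (d : forall i, graded_hom (P i.+1) (P i)) (eps : graded_hom (P 0) M),
    [/\ forall i, finite_free (P i),
        forall i n (x : P i n), (l < i)%N -> x = 0,
        forall n (y : M n), exists x : P 0 n, eps n x = y,
        forall n (x : P 0 n), eps n x = 0 <-> exists y, d 0 n y = x
      & forall i n (x : P i.+1 n), d i n x = 0 <-> exists y, d i.+1 n y = x].

End GradedFreeResolutions.

Record free_resolution (R : comNzRingType) (M : lmodType R) := FreeResolution {
  fres_cplx :> chain_complex R;
  fres_neg : forall i (x : fres_cplx i), (i < 0)%R -> x = 0;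
  fres_free : forall i, free_module (fres_cplx i);
  fres_aug : {linear fres_cplx 0 -> M};
  fres_aug_surj : forall y : M, exists x, fres_aug x = y;
  fres_exact0 : forall x : fres_cplx 0,
    fres_aug x = 0 <->
    exists y : fres_cplx 1, ghom_app (cplx_d fres_cplx) 0 y = x;
  fres_exact : forall i (x : fres_cplx i), (0 < i)%R ->
    ghom_app (cplx_d fres_cplx) (i - 1) x = 0 ->
    exists y : fres_cplx (i + 1), ghom_app (cplx_d fres_cplx) i y = x }.

Section Ext.
Variable R : comNzRingType.

(* The homogeneous components are R-modules.  When G resolves the residue
   field k, the maximal ideal acts by zero on them, so this is the k-algebra
   (resp. k-linear module) structure, and maps of graded modules over
   Ext_algebra G are automatically k-linear. *)
Definition Ext_algebra (G : chain_complex R) : graded_algebra R :=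
  {| galg_sort := HomH G G;
     galg_one := HomH_one G;
     galg_mul := @HomH_mul R G G G;
     galg_mul_linearl := @HomH_mul_linearl R G G G;
     galg_mul_linearr := @HomH_mul_linearr R G G G;
     galg_mulA := @HomH_mulA R G G G G;
     galg_mul1l := @HomH_mul1l R G G;
     galg_mul1r := @HomH_mul1r R G G |}.

Definition Ext_module (F G : chain_complex R) :
    graded_module (Ext_algebra G) :=
  @GradedModule R (Ext_algebra G) (HomH F G)
    (@HomH_mul R F G G) (@HomH_mul_linearl R F G G)
    (@HomH_mul_linearr R F G G) (@HomH_mulA R F G G G)
    (@HomH_mul1l R F G).

End Ext.

(* Main.v *)
Require Import Defs.
From HB Require Import structures.
From mathcomp Require Import all_boot all_order all_algebra.
From mathcomp Require Import boolp classical_sets.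
From mathcomp Require Import zify.

(* A Conca generator x of m gives x^2 = 0 and m^2 = x m, hence m^3 = 0.  In a
   minimal resolution C, with syzygies Z_(i+1) = im (C_(i+1) -> C_i), this
   makes the minimal number of generators of m Z_i / x Z_i nonincreasing in i;
   once it is constant, m Z_(i+1) = m^2 C_i, that is, some truncation of C is
   a linear resolution of a Koszul module K with m^2 K = 0.

   For such K, choose f from a minimal resolution D of m K = k^r to the
   resolution of K lifting the inclusion.  Linearity puts the image of f in m
   times its target, so the cone of f is a minimal resolution of K / m K = k^n
   and Hom(-, k) gives an exact sequence
     0 -> Ext(k^r, k)[-1] -> Ext(k^n, k) -> Ext(K, k) -> 0
   of E-modules, the first two being free.  The same sequence for K = m k^n
   resolves a module Ext concentrated in a single degree by free modules in
   length 2, and Ext(L, k) is reached from Ext(K, k) by finitely many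
   extensions by such modules, to which the horseshoe lemma applies.

   Exactness is tested on cochains: for C a complex of projectives and D a
   resolution of N, H^n Hom(C, D) is H^n Hom(C, N), and if C is minimal then
   H^n Hom(C, k) = Hom(C_n, k). *)

Set Implicit Arguments.
Unset Strict Implicit.
Unset Printing Implicit Defensive.

Import GRing.Theory Order.TTheory.
Local Open Scope ring_scope.

(** * Lifting along resolutions *)

Arguments ghom_app : simpl never.

(** The given [F] and [G] are arbitrary free resolutions, with possibly infinite bases and no
    minimality. On the side of [L] minimality is restored by the comparison theorem; [G] serves
    throughout as a mere projective resolution of k. The numbers of generators decide the matter
    because m^3 = 0: m^2 C_i is killed by m, hence is a vector space over k, and m Z_(i+1) is a
    subspace of it containing x Z_(i+1). One step of the resolution bounds not only the dimension of
    m Z_(i+1) / x Z_(i+1) but that of m^2 C_i / x Z_(i+1) by the previous number; when the number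
    does not drop, the two spaces coincide. The same identity gives m^2 K = 0, since a syzygy K lies
    in m C. Syzygies, quotients V / m V and shifts would each bring new modules and transports
    between equal degrees. An augmentation is therefore allowed a target larger than its image, so
    that a differential can augment a truncation; V / m V appears as a map onto k^n; and a shift is
    only a change of the degree in which a resolution starts. *)

Definition mklin (R : comNzRingType) (A B : lmodType R) (f : A -> B)
    (lf : linear f) : {linear A -> B} :=
  HB.pack f (GRing.isLinear.Build R A B *:%R f lf).

(** Projectivity with containment of images in place of surjectivity of [g], so that a map can be
    lifted through a differential without making its image a module. *)
Definition lift_property (R : comNzRingType) (P : lmodType R) : Prop :=
  forall (A B : lmodType R) (g : {linear A -> B}) (f : {linear P -> B}),
    (forall p, exists a, g a = f p) ->
    exists h : {linear P -> A}, forall p, g (h p) = f p.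

Lemma dependent_choice_nat (T : Type) (P : nat -> T -> Prop)
    (Q : nat -> T -> T -> Prop) :
  (exists x, P 0%N x) ->
  (forall n x, P n x -> exists y, P n.+1 y /\ Q n x y) ->
  exists f : nat -> T, forall n, P n (f n) /\ Q n (f n) (f n.+1).
Proof.
move=> ex0 step; case: (cid ex0) => x0 P0.
have nxt n (x : {x | P n x}) : {y : {y | P n.+1 y} | Q n (sval x) (sval y)}.
  by have [y [Py Qxy]] := cid (step n _ (svalP x)); exists (exist _ y Py).
pose fix f n : {x | P n x} :=
  if n is n'.+1 then sval (nxt n' (f n')) else exist _ x0 P0.
exists (fun n => sval (f n)) => n; split; first exact: (svalP (f n)).
exact: (svalP (nxt n (f n))).
Qed.

Section SingleComponent.
Variables (R : comNzRingType) (F G : int -> lmodType R).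
Variables (n i0 j0 : int) (e0 : i0 = j0 + n) (h : {linear F i0 -> G j0}).

Definition ghom_single : ghom F G n.
Proof.
exists (fun i j x =>
  if @eqP _ i i0 is ReflectT ei then
    if @eqP _ j0 j is ReflectT ej then
      eq_rect j0 G (h (eq_rect i F x i0 ei)) j ej
    else 0
  else 0).
  move=> i j a x y; case: eqP => [ei|_]; last by rewrite scaler0 addr0.
  case: eqP => [ej|_]; last by rewrite scaler0 addr0.
  by case: _ / ej; move: h; case: _ / ei => h' /=; rewrite linearP.
move=> i j x; case: eqP => [ei|//]; case: eqP => [ej|//].
by move=> /eqP[]; rewrite -ej ei e0.
Defined.

Lemma ghom_singleE x : ghom_app ghom_single j0 (x : F i0) = h x.
Proof.
rewrite /ghom_app /=; case: eqP => // ei; case: eqP => // ej.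
by rewrite (Prop_irrelevance ei erefl) (Prop_irrelevance ej erefl).
Qed.

Lemma ghom_single0 i j (x : F i) : j != j0 -> ghom_app ghom_single j x = 0.
Proof.
rewrite /ghom_app /= => ne; case: eqP => // ei; case: eqP => // ej.
by rewrite ej eqxx in ne.
Qed.

End SingleComponent.

Section Lifting.
Variable R : comNzRingType.

Lemma cplx_ddE (C : chain_complex R) i j l (x : C i) :
  ghom_app (cplx_d C) l (ghom_app (cplx_d C) j x) = 0.
Proof.
have [ij|ij] := eqVneq i (j + 1); last by rewrite (ghom_app0 _ _ ij) linear0.
by rewrite -(ghom_compE erefl _ _ _ _ ij) cplx_dd.
Qed.

(** The indices are tied by equations, so components at degrees that are equal but not convertible
    can be named freely; off the degree of the cochain both sides vanish. *)
Lemma hom_dE (C D : chain_complex R) n p (e : n + 1 = p) (f : ghom C D n)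
    i j i' j' (x : C i) : j' = j + 1 -> i = i' + 1 ->
  ghom_app (hom_d e f) j x =
    ghom_app (cplx_d D) j (ghom_app f j' x)
      - (-1) ^+ absz n *: ghom_app f j (ghom_app (cplx_d C) i' x).
Proof.
move=> ej ei; rewrite /hom_d ghom_appD ghom_appN ghom_appZ.
rewrite (ghom_compE _ _ _ _ _ ei); congr (_ - _).
have [h|h] := eqVneq i (j + p).
  by rewrite (@ghom_compE _ _ _ _ _ _ _ _ _ _ i j') // h ej -e; lia.
rewrite ghom_app0 // (@ghom_app0 _ _ _ _ f i j') ?linear0 //.
by apply: contra_neq h => ->; rewrite ej -e; lia.
Qed.

Lemma hom_dd (C D : chain_complex R) n p q (e : n + 1 = p) (e' : p + 1 = q)
    (f : ghom C D n) : hom_d e' (hom_d e f) = 0.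
Proof.
apply: ghomP => i j x.
rewrite (hom_dE e' _ x (erefl (j + 1)) (esym (subrK 1 i))).
rewrite (hom_dE e _ _ (erefl (j + 1 + 1)) (esym (subrK 1 i))).
rewrite (hom_dE e _ _ (erefl (j + 1)) (esym (subrK 1 (i - 1)))).
rewrite linearB linearZ_LR /= !cplx_ddE linear0 scaler0 sub0r subr0.
have <- : - (-1) ^+ absz n = (-1) ^+ absz p :> R.
  by rewrite -e (signzD R n 1) expr1 mulrN1.
by rewrite scaleNr opprK addrC subrr.
Qed.

(* D is a resolution of the image of eps, placed in degrees >= s. *)
Definition resolves (D : chain_complex R) (s : int) (N : lmodType R)
    (eps : {linear D s -> N}) : Prop :=
  [/\ forall (i : int) (x : D i), (i < s)%R -> x = 0,
      forall x : D s, eps x = 0 <->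
        exists y : D (s + 1), ghom_app (cplx_d D) s y = x
    & forall (i j l : int) (x : D j), i = j + 1 -> j = l + 1 -> (s < j)%R ->
        ghom_app (cplx_d D) l x = 0 ->
        exists y : D i, ghom_app (cplx_d D) j y = x].

Definition projective_complex (C : chain_complex R) : Prop :=
  forall i, lift_property (C i).

(** Degree by degree correction: the error [hom_d e f - z] is a cocycle, so where it first fails to
    vanish it is a boundary, and projectivity absorbs it into [f]. The case [z = 0] lifts cochains
    with values in [N]; the case [phi = 0] shows that a cocycle with zero augmentation is a
    coboundary. *)
Lemma extend_ghom (C D : chain_complex R) s (N : lmodType R)
    (eps : {linear D s -> N}) (n p : int)
    (e : n + 1 = p) (z : ghom C D p) (i i' : int) (phi : {linear C i -> N}) :
  projective_complex C -> resolves eps ->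
  hom_d (erefl (p + 1)) z = 0 -> i = s + n -> i' = i + 1 ->
  (forall x, exists y, eps y = phi x) ->
  (forall x : C i', eps (ghom_app z s x) =
     - ((-1) ^+ absz n *: phi (ghom_app (cplx_d C) i x))) ->
  exists u : ghom C D n, hom_d e u = z /\
    forall x : C i, eps (ghom_app u s x) = phi x.
Proof.
move=> pC [D0 Ds Dex] dz ei ei' im_phi ephi.
pose err (f : ghom C D n) := hom_d e f - z.
have derr f : hom_d (erefl (p + 1)) (err f) = 0.
  by rewrite linearB /= dz subr0 hom_dd.
(* At stage [t] the error vanishes in target degrees below [s + t] and is a boundary in degree
   [s + t]; [Q] freezes the components up to [s + t], so that the stages have a limit. *)
pose P t (f : ghom C D n) := [/\
  forall x : C i, eps (ghom_app f s x) = phi x,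
  forall (a j : int) (x : C a), (j < s + Posz t)%R -> ghom_app (err f) j x = 0
  & forall a (x : C a), exists y : D (s + Posz t + 1),
      ghom_app (cplx_d D) _ y = ghom_app (err f) (s + Posz t) x].
pose Q t (f g : ghom C D n) := forall (a j : int) (x : C a),
  (j < s + Posz t + 1)%R -> ghom_app g j x = ghom_app f j x.
have [||F PF] := @dependent_choice_nat _ P Q.
- have [h hE] := pC i _ _ eps phi im_phi.
  exists (ghom_single ei h); split=> [x|a j x js|a x].
  + by rewrite ghom_singleE.
  + by rewrite [LHS]D0 //; move: js; lia.
  + have [ea|ea] := eqVneq a i'; last first.
      exists 0; rewrite linear0 ghom_app0 //.
      by apply: contra_neq ea => ->; rewrite ei' ei -e; lia.
    subst a.
    have: eps (ghom_app (err (ghom_single ei h)) s x) = 0.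
      rewrite ghom_appD ghom_appN linearB ephi.
      rewrite (hom_dE e _ x (erefl (s + 1)) ei') linearB linearZ_LR /=.
      rewrite (ghom_singleE ei h) hE ghom_single0; last by apply/eqP; lia.
      by rewrite !linear0 sub0r opprK addNr.
    move: (err _) => w /Ds.
    by have -> : s + Posz 0 = s by lia.
- move=> t f [f1 f2 f3].
  have [h hE] := pC (s + Posz t + 1 + n) _ _
    (mklin (fun a => linearP (@ghom_app R D D 1 (cplx_d D) _ (s + Posz t)) a)
      : {linear D (s + Posz t + 1) -> _})
    (mklin (fun a => linearP (@ghom_app R C D p (err f) _ (s + Posz t)) a)
      : {linear C (s + Posz t + 1 + n) -> _}) (fun x => f3 _ x).
  rewrite /= in hE.
  pose g := f - ghom_single erefl h.
  have gE j a (x : C a) : j != s + Posz t + 1 ->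
      ghom_app g j x = ghom_app f j x.
    by move=> ne; rewrite ghom_appD ghom_appN (ghom_single0 _ _ _ ne) subr0.
  have errE j a (x : C a) : (j < s + Posz t)%R ->
      ghom_app (err g) j x = 0.
    move=> js; rewrite -(f2 a j x js) /err.
    rewrite !(ghom_appD (hom_d e _) (- z)); congr (_ + _).
    rewrite !(hom_dE e _ x (erefl (j + 1)) (esym (subrK 1 a))).
    by rewrite !gE //; apply/eqP; lia.
  have errE' a (x : C a) : ghom_app (err g) (s + Posz t) x = 0.
    have [ea|ea] := eqVneq a (s + Posz t + p); last by rewrite ghom_app0.
    have ea' : a = s + Posz t + 1 + n by rewrite ea -e; lia.
    clear ea; subst a.
    rewrite /err (ghom_appD (hom_d e g) (- z)) ghom_appN.
    rewrite (hom_dE e _ x (erefl (s + Posz t + 1)) (esym (subrK 1 _))).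
    rewrite [ghom_app g (s + Posz t) _]gE; last by apply/eqP; lia.
    rewrite ghom_appD ghom_appN linearB /= ghom_singleE hE.
    rewrite (ghom_appD (hom_d e f) (- z)) ghom_appN.
    rewrite (hom_dE e _ x (erefl (s + Posz t + 1)) (esym (subrK 1 _))).
    have cancel (V : zmodType) (u v w : V) : u - (u - v - w) - v - w = 0.
      by rewrite -[u - v - w]addrA -opprD subKr -addrA -opprD subrr.
    exact: cancel.
  exists g; split; last by move=> a j x js; rewrite gE //; apply/eqP; lia.
  have le j : (j < s + Posz t.+1)%R -> (j < s + Posz t)%R \/ j = s + Posz t.
    by lia.
  split=> [x|a j x /le[/errE->|->]//|a x].
  + by rewrite gE ?f1 //; apply/eqP; lia.
  + apply: (@Dex _ (s + Posz t.+1) (s + Posz t)) => //; try lia.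
    have := congr1 (fun w => ghom_app w (s + Posz t) x) (derr g).
    rewrite (hom_dE erefl _ x (erefl (s + Posz t + 1)) (esym (subrK 1 a))) errE'.
    rewrite scaler0 subr0.
    by have -> : s + Posz t + 1 = s + Posz t.+1 by lia.
have FE t t' a j (x : C a) : (t <= t')%N -> (j < s + Posz t + 1)%R ->
    ghom_app (F t') j x = ghom_app (F t) j x.
  move=> /subnK<-; elim: (t' - t)%N => // l IHl js.
  by rewrite addSn (proj2 (PF _)) ?IHl //; lia.
(* Diagonal limit: from degree [s] on, [absz (j - s)] is a stage at which the component into [D j]
   is frozen; below [s] the target is zero and any stage serves. *)
pose U : ghom C D n := @GHom R C D n
  (fun a j x => ghom_app (F (absz (j - s))) j x)
  (fun a j => linearP _) (fun a j x => ghom_app0 (F (absz (j - s))) x).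
have UE t a j (x : C a) : (j < s + Posz t + 1)%R ->
    ghom_app U j x = ghom_app (F t) j x.
  move=> js; rewrite {1}/ghom_app /=.
  have [lt|ge] := ltP j s; first by rewrite [LHS]D0 // [RHS]D0.
  by rewrite -(@FE (absz (j - s)) t) //; lia.
exists U; split.
- apply: ghomP => a j x.
  have [lt|ge] := ltP j s; first by rewrite [LHS]D0 // [RHS]D0.
  (* One stage further, since the invariant kills the error only strictly below [s + t]. *)
  set t := (absz (j - s)).+1.
  have [[_ /(_ a j x) err0 _] _] := PF t.
  have /err0 : (j < s + Posz t)%R by lia.
  rewrite /err (ghom_appD (hom_d e _) (- z)) ghom_appN => /eqP.
  rewrite subr_eq0 => /eqP <-.
  rewrite !(hom_dE e _ x (erefl (j + 1)) (esym (subrK 1 a))).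
  by rewrite !(UE t) //; lia.
- move=> x; rewrite (UE 0%N); last by lia.
  by have [[]] := PF 0%N.
Qed.

End Lifting.

(** * Classes of Hom(C, D) and cochains with values in the resolved module *)

Section Represents.
Variable R : comNzRingType.
Implicit Types C D : chain_complex R.

(** The comparison of H^n Hom(C, D) with cochains [C i -> N], where [i = s + n], kept as a relation
    since a class determines its cochain only up to coboundaries. [represents_lift] and
    [represents_eq] give its surjectivity and injectivity. *)
Definition represents C D s (N : lmodType R) (eps : {linear D s -> N}) n
    (x : HomH C D n) i (phi : C i -> N) : Prop :=
  exists z : cocycle C D n, HomH_class z = x /\
    forall y : C i, phi y = eps (ghom_app (cycle_val z) s y).

Section Fixed.
Variables (C D : chain_complex R) (s : int) (N : lmodType R).
Variable eps : {linear D s -> N}.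
Local Notation represents := (represents eps).

Lemma represents_ext n (x : HomH C D n) i (phi psi : C i -> N) :
  represents x phi -> phi =1 psi -> represents x psi.
Proof. by move=> [z [zx zphi]] e; exists z; split=> // y; rewrite -e. Qed.

Lemma represents_exists n (x : HomH C D n) i : resolves eps -> i = s + n ->
  exists phi : {linear C i -> N}, represents x phi /\
    forall y : C (i + 1), phi (ghom_app (cplx_d C) i y) = 0.
Proof.
move=> [_ Ds _] ei; pose z := HomH_repr x.
have lin : linear (fun y : C i => eps (ghom_app (cycle_val z) s y)).
  by move=> a u v; rewrite !linearP.
exists (mklin lin); split=> [|y].
  by exists z; split=> //; apply: HomH_classK.
have := congr1 (fun w => eps (ghom_app w s y)) (cocycleP erefl z).
rewrite (hom_dE erefl _ y (erefl (s + 1)) (erefl (i + 1))) linear0 linearB.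
rewrite linearZ_LR [X in X - _](_ : _ = 0); last by apply/Ds; eexists.
rewrite sub0r => /eqP; rewrite oppr_eq0 => /eqP /(congr1 ( *:%R ((-1) ^+ `|n|%N))).
by rewrite scaler0 scalerA -expr2 sqrr_sign scale1r.
Qed.

Lemma represents_lift n i (phi : {linear C i -> N}) :
  projective_complex C -> resolves eps -> i = s + n ->
  (forall x, exists y, eps y = phi x) ->
  (forall y : C (i + 1), phi (ghom_app (cplx_d C) i y) = 0) ->
  exists x : HomH C D n, represents x phi.
Proof.
move=> pC rD ei im dphi.
have [||u [du ephi]] :=
  @extend_ghom R C D s N eps n (n + 1) erefl 0 i (i + 1) phi pC rD _ ei erefl im.
- by rewrite linear0.
- by move=> x; rewrite linear0 dphi scaler0 oppr0.
have zu : u \in cycle_pred (hom_d (erefl (n + 1))) by apply/eqP.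
by exists (HomH_class (Cycle zu : cocycle C D n)); eexists; split.
Qed.

Lemma represents_eq n (x y : HomH C D n) i (phi psi : C i -> N) :
  projective_complex C -> resolves eps -> i = s + n ->
  represents x phi -> represents y psi -> phi =1 psi -> x = y.
Proof.
move=> pC rD ei [z [<- zphi]] [w [<- wpsi]] e.
apply/hclassP.
have lin : linear (fun _ : C (i - 1) => 0 : N).
  by move=> a u v; rewrite scaler0 addr0.
have [|||||u [du _]] := @extend_ghom R C D s N eps (n - 1) n (subrK 1 n)
  (cycle_val z - cycle_val w) (i - 1) i (mklin lin) pC rD.
- by rewrite linearB /= !(cocycleP erefl) subr0.
- by rewrite ei; lia.
- lia.
- by move=> v; exists 0; rewrite linear0.
- move=> v; rewrite scaler0 oppr0 ghom_appD ghom_appN linearB.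
  by rewrite -zphi -wpsi e subrr.
by exists u.
Qed.

Lemma represents0 n i : represents (0 : HomH C D n) (fun _ : C i => 0).
Proof.
exists 0; split; first exact: linear0.
by move=> y; rewrite [ghom_app _ _ _](_ : _ = 0) ?linear0.
Qed.

Lemma representsD n (x y : HomH C D n) i (phi psi : C i -> N) :
  represents x phi -> represents y psi ->
  represents (x + y) (fun v => phi v + psi v).
Proof.
move=> [z [<- zphi]] [w [<- wpsi]]; exists (z + w); split.
  by rewrite /HomH_class raddfD.
by move=> v; rewrite zphi wpsi -linearD.
Qed.

Lemma represents_sum n (I : Type) (r : seq I) (x : I -> HomH C D n) i
    (phi : I -> C i -> N) :
  (forall j, represents (x j) (phi j)) ->
  represents (\sum_(j <- r) x j) (fun v => \sum_(j <- r) phi j v).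
Proof.
move=> xphi; elim: r => [|j r IHr].
  rewrite big_nil; apply: represents_ext (represents0 n i) _ => v.
  by rewrite big_nil.
rewrite big_cons; apply: represents_ext (representsD (xphi j) IHr) _ => v.
by rewrite big_cons.
Qed.

(** A product is read off by precomposing the cochain with the cocycle, so identities in Ext become
    identities between cochains, checked without writing down a homotopy. *)
Lemma represents_mul C' n q p (e : n + q = p) (x : HomH C D n)
    (a : cocycle C' C q) i i' (phi : C i -> N) :
  i = s + n -> represents x phi ->
  represents (HomH_mul e x (HomH_class a))
    (fun y : C' i' => phi (ghom_app (cycle_val a) i y)).
Proof.
move=> ei [z [<- zphi]]; exists (cocycle_comp e z a); split.
  by rewrite HomH_mulE.
move=> y; rewrite zphi /=; congr (eps _).
have [h|h] := eqVneq i' (i + q).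
  by rewrite (ghom_compE _ _ _ _ _ h).
rewrite [ghom_app (cycle_val a) i y]ghom_app0 // linear0 ghom_app0 //.
by apply: contra_neq h => ->; rewrite ei -e addrA.
Qed.

End Fixed.

Lemma represents_one C s (N : lmodType R) (eps : {linear C s -> N}) :
  represents eps (HomH_one C) eps.
Proof.
by exists (cocycle_id C); split=> // y; rewrite /= ghom_idE.
Qed.

End Represents.

(** * Graded modules of finite free dimension *)

Section GradedModules.
Variables (R : comNzRingType) (A : graded_algebra R).
Implicit Types M N P : graded_module A.

HB.instance Definition _ M m n p (e : m + n = p) (a : A m) :=
  GRing.isLinear.Build R (M n) (M p) *:%R (gmod_act e a)
    (@gmod_act_linearr R A M m n p e a).
HB.instance Definition _ M N (h : graded_hom M N) n :=
  GRing.isLinear.Build R (M n) (N n) *:%R (@ghm_fun R A M N h n)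
    (@ghm_linear R A M N h n).

Definition ghom_gid M : graded_hom M M.
Proof. by exists (fun _ x => x). Defined.

Definition ghom_gcomp M N P (g : graded_hom N P) (f : graded_hom M N) :
  graded_hom M P.
Proof.
exists (fun n x => g n (f n x)) => [n a x y|m n p e a x]; first by rewrite !linearP.
by rewrite !ghm_act.
Defined.

Definition gzero : graded_module A.
Proof.
exists (fun _ => 'rV[R]_0) (fun _ _ _ _ _ _ => 0) => //.
- by move=> m n p e x a b c; rewrite scaler0 addr0.
- by move=> m n p e x a b c; rewrite scaler0 addr0.
- by move=> n e x; apply/rowP; case.
Defined.

Definition ghom_gzero M N : graded_hom M N.
Proof.
exists (fun n x => 0) => [n a x y|m n p e a x]; first by rewrite scaler0 addr0.
by rewrite linear0.
Defined.

Section Kernel.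
Variables (M N : graded_module A) (h : graded_hom M N).

Definition gker_act m n p (e : m + n = p) (a : A m) (x : Defs.cycle (h n)) :
  Defs.cycle (h p).
Proof.
exists (gmod_act e a (cycle_val x)); apply/eqP.
by rewrite /= ghm_act; case: x => x /eqP /= ->; rewrite linear0.
Defined.

Definition gker : graded_module A.
Proof.
exists (fun n => Defs.cycle (h n)) gker_act.
- by move=> m n p e x a b c; apply: val_inj; apply: gmod_act_linearl.
- by move=> m n p e a b x y; apply: val_inj; apply: gmod_act_linearr.
- by move=> *; apply: val_inj; apply: gmod_actA.
- by move=> n e x; apply: val_inj; apply: gmod_act1.
Defined.

Definition gker_val : graded_hom gker M.
Proof. by exists (fun n (x : Defs.cycle (h n)) => cycle_val x). Defined.

Lemma gker_valP n (x : gker n) : h n (gker_val n x) = 0.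
Proof. exact: (eqP (valP (x : Defs.cycle (h n)))). Qed.

Lemma gker_val_inj n : injective (gker_val n).
Proof. exact: val_inj. Qed.

Lemma gkerP n (x : M n) : h n x = 0 -> exists y : gker n, gker_val n y = x.
Proof.
move=> hx; have xk : x \in cycle_pred (h n) by apply/eqP.
by exists (Cycle xk).
Qed.

Lemma gker_lift P (g : graded_hom P M) : (forall n x, h n (g n x) = 0) ->
  exists g' : graded_hom P gker, forall n x, gker_val n (g' n x) = g n x.
Proof.
move=> hg; have gk n x : g n x \in cycle_pred (h n) by apply/eqP/hg.
have lin n : linear (fun x => Cycle (gk n x) : gker n).
  by move=> a x y; apply: val_inj; apply: linearP.
have act m n p (e : m + n = p) (a : A m) (x : P n) :
    Cycle (gk p (gmod_act e a x)) = gmod_act e a (Cycle (gk n x) : gker n).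
  by apply: val_inj; apply: ghm_act.
by exists (GradedHom (N := gker) lin act).
Qed.

End Kernel.

Definition gprod M N : graded_module A.
Proof.
exists (fun n => (M n * N n)%type)
  (fun m n p e a x => (gmod_act e a x.1, gmod_act e a x.2)).
- by move=> m n p e x a b c; congr pair; apply: gmod_act_linearl.
- by move=> m n p e a b x y; congr pair; apply: gmod_act_linearr.
- by move=> l m n lm mn p e1 e2 e3 e4 a b x; congr pair; apply: gmod_actA.
- by move=> n e [x y]; congr pair; apply: gmod_act1.
Defined.

Definition gprod_inl M N : graded_hom M (gprod M N).
Proof.
exists (fun n (x : M n) => ((x, 0) : M n * N n)%type) => [n a x y|m n r e a x];
  congr pair.
  by rewrite [RHS](_ : _ = a *: 0 + 0) // scaler0 addr0.
by rewrite [RHS](_ : _ = gmod_act e a 0) // linear0.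
Defined.

Definition gprod_snd M N : graded_hom (gprod M N) N.
Proof. by exists (fun n (x : (M n * N n)%type) => x.2). Defined.

Definition short_exact M' M M'' (f : graded_hom M' M) (g : graded_hom M M'') :=
  [/\ forall n, injective (f n), forall n y, exists x, g n x = y
    & forall n x, g n x = 0 <-> exists y, f n y = x].

Definition bijective_hom M N (h : graded_hom M N) :=
  (forall n, injective (h n)) /\ (forall n y, exists x, h n x = y).

(* [finite_free] with an arbitrary finite index type, so that bases can be
   indexed by disjoint unions. *)
Definition fin_free M : Prop :=
  exists (I : finType) (d : I -> int) (b : forall s, M (d s)),
    forall n (x : M n), exists! a : forall s, A (n - d s),
      x = \sum_s gmod_act (subrK (d s) n) (a s) (b s).

Lemma fin_free_finite_free M : fin_free M -> finite_free M.
Proof.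
move=> [I [d [b bM]]].
exists #|I|, (fun s => d (enum_val s)), (fun s => b (enum_val s)) => n x.
have [a [xa a_uniq]] := bM n x.
have sumE (c : forall s, A (n - d s)) :
    \sum_s gmod_act (subrK (d s) n) (c s) (b s) =
    \sum_(s < #|I|) gmod_act (subrK (d (enum_val s)) n) (c (enum_val s))
      (b (enum_val s)).
  by rewrite (reindex (@enum_val I (mem I))) //; apply/onW_bij/enum_val_bij.
exists (fun s => a (enum_val s)); split; first by rewrite -sumE.
move=> a' xa'.
(* The type of a coefficient depends on the degree of its basis element, so [a'] is transported
   along [enum_rankK]. *)
pose c s : A (n - d s) :=
  eq_rect _ (fun t => A (n - d t)) (a' (enum_rank s)) _ (enum_rankK s).
have cE s : c (enum_val s) = a' s.
  rewrite /c; move: (enum_rankK (enum_val s)); rewrite enum_valK => e.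
  by rewrite (Prop_irrelevance e erefl).
have -> : a = c.
  apply: a_uniq; rewrite sumE xa'; apply: eq_bigr => s _.
  by rewrite cE.
by apply: functional_extensionality_dep => s; apply: cE.
Qed.

Lemma fin_free_zero M : (forall n (x : M n), x = 0) -> fin_free M.
Proof.
move=> M0; exists void, (fun=> 0), (fun=> 0).
move=> n x; exists (fun=> 0); split; first by rewrite [LHS]M0 [RHS]M0.
by move=> a _; apply: functional_extensionality_dep; case.
Qed.

Lemma fin_free_iso M N (h : graded_hom M N) :
  bijective_hom h -> fin_free M -> fin_free N.
Proof.
move=> [hi hs] [I [d [b bM]]]; exists I, d, (fun s => h _ (b s)) => n y.
have sumE (c : forall s, A (n - d s)) :
    \sum_s gmod_act (subrK (d s) n) (c s) (h _ (b s)) =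
    h n (\sum_s gmod_act (subrK (d s) n) (c s) (b s)).
  by rewrite linear_sum; apply: eq_bigr => s _; rewrite /= ghm_act.
have [x <-] := hs n y; have [a [xa a_uniq]] := bM n x.
exists a; split; first by rewrite sumE -xa.
by move=> a'; rewrite sumE => /hi/a_uniq.
Qed.

(** Free graded modules are projective: lifts of the images of the basis are combined with the
    coordinates, and uniqueness of coordinates makes the result linear and compatible with the
    action. *)
Lemma fin_free_lift P M N (g : graded_hom M N) (p : graded_hom P N) :
  fin_free P -> (forall n y, exists x, g n x = y) ->
  exists q : graded_hom P M, forall n x, g n (q n x) = p n x.
Proof.
move=> [I [d [b bP]]] gs.
have [w wE] : exists w : forall s, M (d s), forall s, g _ (w s) = p _ (b s).
  exists (fun s => sval (cid (gs _ (p _ (b s))))) => s.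
  by case: (cid _).
pose c n (x : P n) := sval (cid (bP n x)).
have cE n x : x = \sum_s gmod_act (subrK (d s) n) (c n x s) (b s).
  by rewrite /c; case: (cid _) => a [].
have cU n x a : x = \sum_s gmod_act (subrK (d s) n) (a s) (b s) ->
    forall s, c n x s = a s.
  by move=> xa s; rewrite /c; case: (cid _) => a' /= [_ aU]; rewrite (aU _ xa).
have lin n : linear (fun x : P n =>
    \sum_s gmod_act (subrK (d s) n) (c n x s) (w s)).
  move=> a x y; rewrite scaler_sumr -big_split; apply: eq_bigr => s _ /=.
  rewrite (cU _ _ (fun s => a *: c n x s + c n y s)).
    by rewrite gmod_act_linearl.
  rewrite {1}(cE n x) {1}(cE n y) scaler_sumr -big_split; apply: eq_bigr => t _ /=.
  by rewrite gmod_act_linearl.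
have act m n p' (e : m + n = p') (a : A m) (x : P n) :
    \sum_s gmod_act (subrK (d s) p') (c p' (gmod_act e a x) s) (w s) =
    gmod_act e a (\sum_s gmod_act (subrK (d s) n) (c n x s) (w s)).
  have e' s : m + (n - d s) = p' - d s by rewrite -e addrA.
  rewrite linear_sum; apply: eq_bigr => s _ /=.
  rewrite (cU _ _ (fun s => galg_mul (e' s) a (c n x s))).
    exact: gmod_actA.
  rewrite {1}(cE n x) linear_sum; apply: eq_bigr => t _ /=.
  by symmetry; apply: gmod_actA.
exists (GradedHom lin act) => n x /=.
rewrite linear_sum [in RHS](cE n x) linear_sum; apply: eq_bigr => s _ /=.
by rewrite !ghm_act wE.
Qed.

Lemma fin_free_extension M' M M'' (f : graded_hom M' M) (g : graded_hom M M'') :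
  short_exact f g -> fin_free M' -> fin_free M'' -> fin_free M.
Proof.
move=> [fi gs fg] [I' [d' [b' bM']]] [I'' [d'' [b'' bM'']]].
have [w wE] : exists w : forall s, M (d'' s), forall s, g _ (w s) = b'' s.
  by exists (fun s => sval (cid (gs _ (b'' s)))) => s; case: (cid _).
pose d (s : I' + I'') := match s with inl s => d' s | inr s => d'' s end.
pose b s : M (d s) := match s with inl s => f _ (b' s) | inr s => w s end.
exists (I' + I'')%type, d, b => n x.
have sumE (c : forall s, A (n - d s)) :
    \sum_s gmod_act (subrK (d s) n) (c s) (b s) =
    f n (\sum_s gmod_act (subrK (d' s) n) (c (inl s)) (b' s)) +
    \sum_s gmod_act (subrK (d'' s) n) (c (inr s)) (w s).
  rewrite big_sumType linear_sum; congr (_ + _).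
  by apply: eq_bigr => s _ /=; rewrite ghm_act.
have gf y : g n (f n y) = 0 by apply/fg; exists y.
have gsum (c : forall s, A (n - d s)) :
    g n (\sum_s gmod_act (subrK (d s) n) (c s) (b s)) =
    \sum_s gmod_act (subrK (d'' s) n) (c (inr s)) (b'' s).
  rewrite sumE linearD /= gf add0r linear_sum; apply: eq_bigr => s _ /=.
  by rewrite ghm_act wE.
have [a'' [xa'' a''U]] := bM'' n (g n x).
have : g n (x - \sum_s gmod_act (subrK (d'' s) n) (a'' s) (w s)) = 0.
  rewrite linearB /= xa'' linear_sum; apply/eqP; rewrite subr_eq0; apply/eqP.
  by apply: eq_bigr => s _ /=; rewrite ghm_act wE.
move=> /fg[y yE]; have [a' [ya' a'U]] := bM' n y.
pose a s : A (n - d s) := match s with inl s => a' s | inr s => a'' s end.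
exists a; split; first by rewrite sumE -ya' yE subrK.
move=> c xc.
have cr s : c (inr s) = a'' s.
  by rewrite (a''U (fun s => c (inr s))) // -gsum -xc.
apply: functional_extensionality_dep => -[s|s] /=; last by rewrite cr.
rewrite (a'U (fun s => c (inl s))) //; apply: (fi n); rewrite yE xc sumE.
rewrite [X in _ + X - _](eq_bigr (fun t =>
  gmod_act (subrK (d'' t) n) (a'' t) (w t))) ?addrK // => t _.
by rewrite cr.
Qed.

(** A free resolution of length at most [l], peeled off one cover at a time; its last syzygy is the
    free module of the case [0]. This form suits the induction of the horseshoe lemma. *)
Fixpoint free_dim_le (l : nat) M : Prop :=
  if l is l'.+1 then
    exists (P : graded_module A) (p : graded_hom P M),
      [/\ fin_free P, forall n y, exists x, p n x = y & free_dim_le l' (gker p)]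
  else fin_free M.

Lemma free_dim_le_iso l M N (h : graded_hom M N) :
  bijective_hom h -> free_dim_le l M -> free_dim_le l N.
Proof.
elim: l M N h => [|l IHl] M N h hb /=; first exact: (fin_free_iso hb).
move=> [P [p [fP ps fK]]]; exists P, (ghom_gcomp h p); split=> // [n y|].
  by have [x <-] := hb.2 n y; have [u <-] := ps n x; exists u.
have [|k kE] := @gker_lift _ _ (ghom_gcomp h p) _ (gker_val p).
  by move=> n x /=; rewrite gker_valP linear0.
apply: (IHl _ _ k) => //; split=> [n x y kxy|n y].
  by apply: (@gker_val_inj _ _ p); rewrite -!kE kxy.
have : p n (gker_val _ n y) = 0.
  by apply: (hb.1 n); rewrite linear0; apply: (gker_valP y).
move=> /gkerP[x xE]; exists x; apply: gker_val_inj.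
by rewrite kE.
Qed.

(** [f] identifies [M'] with the kernel of the cover [g]; this is how an exact sequence of Ext
    modules with free middle term becomes a bound on dimension. *)
Lemma free_dim_le_short_exact l M' M M'' (f : graded_hom M' M)
    (g : graded_hom M M'') :
  short_exact f g -> fin_free M -> free_dim_le l M' -> free_dim_le l.+1 M''.
Proof.
move=> [fi gs fg] fM fM'; exists M, g; split=> //.
have [|k kE] := @gker_lift _ _ g _ f; first by move=> n x; apply/fg; exists x.
apply: (free_dim_le_iso (h := k)) => //; split=> [n x y kxy|n y].
  by apply: (fi n); rewrite -!kE kxy.
have /fg[x xE] := gker_valP y; exists x; apply: gker_val_inj.
by rewrite kE.
Qed.

Lemma free_dim_leS l M : free_dim_le l M -> free_dim_le l.+1 M.
Proof.
elim: l M => [|l IHl] M; last first.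
  by move=> [P [p [fP ps fK]]]; exists P, p; split=> //; apply: IHl.
move=> fM; apply: (@free_dim_le_short_exact 0 gzero M M (ghom_gzero _ _)
  (ghom_gid M)) => //=; last first.
  by apply: fin_free_zero => n x; apply/rowP; case.
split=> [n x y _|n y|n x]; first by apply/rowP; case.
  by exists y.
by split=> [/= ->|[y /= <-]//]; exists 0.
Qed.

(** Horseshoe lemma: [p'] followed by [f] and a lift of [p''] along [g] together cover [M] by the
    product, and the three kernels again form a short exact sequence. *)
Lemma free_dim_le_extension l M' M M'' (f : graded_hom M' M)
    (g : graded_hom M M'') :
  short_exact f g -> free_dim_le l M' -> free_dim_le l M'' -> free_dim_le l M.
Proof.
elim: l M' M M'' f g => [|l IHl] M' M M'' f g ex /=.
  exact: fin_free_extension ex.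
move=> [P' [p' [fP' p's fK']]] [P'' [p'' [fP'' p''s fK'']]].
have [fi gs fg] := ex.
have [q qE] := fin_free_lift p'' fP'' gs.
have lin n : linear (fun x : gprod P' P'' n => f n (p' n x.1) + q n x.2).
  move=> a x y; rewrite !linearP scalerDr -!addrA; congr (_ + _).
  by rewrite addrCA.
have act m n r (e : m + n = r) (a : A m) (x : gprod P' P'' n) :
    f r (p' r (gmod_act e a x).1) + q r (gmod_act e a x).2 =
    gmod_act e a (f n (p' n x.1) + q n x.2).
  by rewrite linearD /= !ghm_act.
pose p := GradedHom lin act.
have gf n x : g n (f n x) = 0 by apply/fg; exists x.
have gp n x : g n (p n x) = p'' n x.2 by rewrite linearD /= gf add0r qE.
pose i1 := gprod_inl P' P''; pose pr2 := gprod_snd P' P''.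
exists (gprod P' P''), p; split.
- apply: (@fin_free_extension _ _ _ i1 pr2) => //; split=> [n x y []//|n y|n x].
    by exists (0, y).
  split=> [/= x0|[y <-]//].
  by exists x.1; case: x x0 => x1 x2 /= ->.
- move=> n y; have [v vE] := p''s n (g n y).
  have : g n (y - q n v) = 0 by rewrite linearB /= qE vE subrr.
  move=> /fg[x xE]; have [u uE] := p's n x.
  by exists (u, v); rewrite /= uE xE subrK.
have [|k1 k1E] := @gker_lift _ _ p _ (ghom_gcomp i1 (gker_val p')).
  by move=> n x; rewrite /= gker_valP !linear0 addr0.
have [|k2 k2E] := @gker_lift _ _ p'' _ (ghom_gcomp pr2 (gker_val p)).
  by move=> n x; rewrite /= -gp; have := gker_valP x => /= ->; rewrite linear0.
apply: (IHl _ _ _ k1 k2) => //; split.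
- move=> n x y /(congr1 (gker_val p n)); rewrite !k1E => -[].
  exact: gker_val_inj.
- move=> n y; have /fg[x xE] : g n (q n (gker_val p'' n y)) = 0.
    by rewrite qE gker_valP.
  (* The value of [q] at a relation [y] need not vanish, but it comes from [M']; a preimage of the
     opposite element completes [y] to an element of the kernel of [p]. *)
  have [u uE] := p's n (- x).
  have : p n (u, gker_val p'' n y) = 0 by rewrite /= uE linearN /= xE addNr.
  move=> /gkerP[v vE]; exists v; apply: gker_val_inj.
  by rewrite k2E; exact: (congr1 snd vE).
- move=> n x; split=> [x0|[y <-]].
    have x2 : (gker_val p n x).2 = 0.
      by have := k2E n x; rewrite x0 linear0 => /= <-.
    have : p' n (gker_val p n x).1 = 0.
      apply: (fi n); rewrite linear0.
      by have := gker_valP x; rewrite /= x2 linear0 addr0.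
    move=> /gkerP[y yE]; exists y; apply: gker_val_inj.
    rewrite k1E; apply: (etrans (congr1 (fun u => (u, 0)) yE)).
    by move: x2; case: (gker_val p n x) => u v /= ->.
  apply: gker_val_inj; rewrite k2E linear0.
  exact: (congr1 snd (k1E n y)).
Qed.

Lemma free_dim_le2_resolution M :
  free_dim_le 2 M -> has_finite_free_resolution M 2.
Proof.
move=> [P0 [p0 [fP0 p0s [P1 [p1 [fP1 p1s fK1]]]]]].
pose P i := match i with
  | 0 => P0 | 1 => P1 | 2 => gker p1 | _ => gzero end%N.
have z3 : fin_free gzero by apply: fin_free_zero => n x; apply/rowP; case.
pose d i : graded_hom (P i.+1) (P i) := match i with
  | 0 => ghom_gcomp (gker_val p0) p1 | 1 => gker_val p1 | _ => ghom_gzero _ _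
  end%N.
exists P, d, p0; split=> //.
- by move=> [|[|[|i]]]; apply: fin_free_finite_free.
- by move=> [|[|[|i]]] n x //= _; apply/rowP; case.
- move=> n x; split=> [/gkerP[y <-]|[y <-]].
    by have [u <-] := p1s n y; exists u.
  exact: (gker_valP (p1 n y)).
- move=> [|[|i]] n x; split.
  + move=> x0; have p1x : p1 n x = 0 by apply: gker_val_inj; rewrite linear0.
    by have [y yE] := gkerP p1x; exists y.
  + move=> [y <-]; change (gker_val p0 n (p1 n (gker_val p1 n y)) = 0).
    by rewrite gker_valP linear0.
  + move=> x0; exists 0; rewrite linear0; symmetry.
    by apply: gker_val_inj; rewrite linear0.
  + by move=> [y <-] /=.
  + by move=> _; exists 0; apply/rowP; case.
  + by [].
Qed.

End GradedModules.

(** * Ext modules *)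

Lemma fun_choice (T U : Type) (P : T -> U -> Prop) :
  (forall t, exists u, P t u) -> exists f : T -> U, forall t, P t (f t).
Proof. by move=> PTU; exists (fun t => sval (cid (PTU t))) => t; case: (cid _). Qed.

Lemma HomH_mul_sumr (R : comNzRingType) (F G H : chain_complex R) m n p
    (e : m + n = p) (x : HomH G H m) (I : finType) (y : I -> HomH F G n) :
  HomH_mul e x (\sum_i y i) = \sum_i HomH_mul e x (y i).
Proof. exact: (linear_sum (mklin (HomH_mul_linearr e x))). Qed.

Lemma HomH_mul_suml (R : comNzRingType) (F G H : chain_complex R) m n p
    (e : m + n = p) (y : HomH F G n) (I : finType) (x : I -> HomH G H m) :
  HomH_mul e (\sum_i x i) y = \sum_i HomH_mul e (x i) y.
Proof. exact: (linear_sum (mklin (HomH_mul_linearl e y))). Qed.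

Section ExtModules.
Variables (R : comNzRingType) (G : chain_complex R).
Local Notation Ext C := (Ext_module C G).

Section Induced.
Variables (C C' : chain_complex R) (a : HomH C C' 0).

Definition ext_map : graded_hom (Ext C') (Ext C).
Proof.
exists (fun n x => HomH_mul (addr0 n) x a) => [n|m n p e b x].
  exact: HomH_mul_linearl.
exact: (HomH_mulA e (addr0 p) (addr0 n) e b x a).
Defined.

End Induced.

Lemma ext_map_mul C C' C'' (b : HomH C' C'' 0) (a : HomH C C' 0) n x :
  ext_map a n (ext_map b n x) = ext_map (HomH_mul (addr0 0) b a) n x.
Proof. exact: HomH_mulA. Qed.

Lemma ext_map_one C n x : ext_map (HomH_one C) n x = x.
Proof. exact: HomH_mul1r. Qed.

Section SameModule.
Variables (C C' : chain_complex R) (s : int) (N : lmodType R).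
Variables (eps : {linear C s -> N}) (eps' : {linear C' s -> N}).
Hypotheses (pC : projective_complex C) (pC' : projective_complex C').
Hypotheses (rC : resolves eps) (rC' : resolves eps').
Hypothesis im : forall x, exists y, eps' y = eps x.

Lemma resolves_d (y : C (s + 1)) : eps (ghom_app (cplx_d C) s y) = 0.
Proof. by have [_ Ds _] := rC; apply/Ds; exists y. Qed.

Lemma comparison_map : exists a : cocycle C C' 0,
  forall x : C s, eps' (ghom_app (cycle_val a) s x) = eps x.
Proof.
have [x [z [_ ze]]] :=
  represents_lift pC rC' (esym (addr0 s)) im resolves_d.
by exists z.
Qed.

End SameModule.

(** Lifts in both directions compose to classes with the augmentation of the identity, hence to the
    identity. Only the images of the two augmentations have to agree, so [N] may be larger than the
    module resolved. *)
Lemma ext_iso (C C' : chain_complex R) s (N : lmodType R) (eps : {linear C s -> N})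
    (eps' : {linear C' s -> N}) :
  projective_complex C -> projective_complex C' ->
  resolves eps -> resolves eps' ->
  (forall x, exists y, eps' y = eps x) -> (forall x, exists y, eps y = eps' x) ->
  exists h : graded_hom (Ext C') (Ext C), bijective_hom h.
Proof.
move=> pC pC' rC rC' im im'.
have [a aE] := comparison_map pC rC rC' im.
have [b bE] := comparison_map pC' rC' rC im'.
have ba : HomH_mul (addr0 0) (HomH_class b) (HomH_class a) = HomH_one C.
  have rb : represents eps (HomH_class b)
      (fun y : C' s => eps (ghom_app (cycle_val b) s y)).
    by exists b.
  apply: (represents_eq pC rC (esym (addr0 s))
    (represents_mul (addr0 0) a s (esym (addr0 s)) rb) (represents_one eps)).
  by move=> y; rewrite bE aE.
have ab : HomH_mul (addr0 0) (HomH_class a) (HomH_class b) = HomH_one C'.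
  have ra : represents eps' (HomH_class a)
      (fun y : C s => eps' (ghom_app (cycle_val a) s y)).
    by exists a.
  apply: (represents_eq pC' rC' (esym (addr0 s))
    (represents_mul (addr0 0) b s (esym (addr0 s)) ra) (represents_one eps')).
  by move=> y; rewrite aE bE.
exists (ext_map (HomH_class a)); split=> [n x y xy|n y].
  rewrite -(ext_map_one x) -(ext_map_one y) -ab -!ext_map_mul.
  by rewrite xy.
by exists (ext_map (HomH_class b) n y); rewrite ext_map_mul ba ext_map_one.
Qed.

(** * Ext with values in the residue field *)

Section ResidueField.
Variables (k : fieldType) (pi : {rmorphism R -> k}).
Local Notation kR := (resmod pi).
Variable epsG : {linear G 0 -> kR}.
Hypotheses (pG : projective_complex G) (rG : resolves epsG).
Hypothesis sG : forall y, exists x, epsG x = y.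

(** The coordinate maps k^r -> k give classes [b j], the coordinate inclusions give classes [cc j]
    of degree [- s]. The relations [bc] (orthonormality) and [cb] (the products [cc j] times [b j]
    sum to 1) say that the [b j] form a basis, the coefficients of [x] being the products of [x]
    with the [cc j]; thus [C] is never split into [r] resolutions of k. *)
Lemma ext_fin_free (C : chain_complex R) s r (eps : {linear C s -> {ffun 'I_r -> kR}}) :
  projective_complex C -> resolves eps -> (forall y, exists x, eps x = y) ->
  fin_free (Ext C).
Proof.
move=> pC rC sC.
pose p j (f : {ffun 'I_r -> kR}) : kR := f j.
have plin j : linear (fun x : C s => p j (eps x)).
  by move=> a x y; rewrite linearP /p !ffunE.
have [b bE] : exists b : 'I_r -> HomH C G s,
    forall j, represents epsG (b j) (fun x : C s => p j (eps x)).
  apply: (fun_choice (P := fun j x => represents epsG x (fun x : C s => p j (eps x)))).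
  move=> j; apply: (represents_lift (phi := mklin (plin j)) pC rG) => //.
    by rewrite add0r.
  by move=> y /=; rewrite (resolves_d rC) /p ffunE.
pose q j (v : kR) : {ffun 'I_r -> kR} := [ffun l => if l == j then v else 0].
have qlin j : linear (fun x : G 0 => q j (epsG x)).
  move=> a x y; apply/ffunP => l; rewrite !ffunE linearP.
  by case: eqP => // _; rewrite scaler0 addr0.
have [c cE] : exists c : 'I_r -> cocycle G C (- s),
    forall j (x : G 0), eps (ghom_app (cycle_val (c j)) s x) = q j (epsG x).
  apply: (fun_choice (P := fun j (c : cocycle G C (- s)) => forall x : G 0,
    eps (ghom_app (cycle_val c) s x) = q j (epsG x))) => j.
  have [||x [z [_ ze]]] := represents_lift (i := 0) (n := - s)
    (phi := mklin (qlin j)) pG rC (esym (subrr s)).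
  - by move=> y; apply: sC.
  - move=> y /=; rewrite (resolves_d rG).
    by apply/ffunP => l; rewrite !ffunE if_same.
  by exists z => y; rewrite -ze.
pose cc j := HomH_class (c j).
have bc j l : HomH_mul (subrr s) (b j) (cc l) =
    if j == l then HomH_one G else 0.
  have rbc := represents_mul (subrr s) (c l) 0 (esym (add0r s)) (bE j).
  case: (eqVneq j l) rbc => [->|jl] rbc.
    apply: (represents_eq pG rG (esym (addr0 0)) rbc (represents_one epsG)) => y.
    by rewrite cE /p ffunE eqxx.
  apply: (represents_eq pG rG (esym (addr0 0)) rbc (represents0 _ _ _ _)) => y.
  by rewrite cE /p ffunE (negbTE jl).
have cb : \sum_j HomH_mul (addNr s) (cc j) (b j) = HomH_one C.
  have [w wE] : exists w : 'I_r -> cocycle C G s, forall j, HomH_class (w j) = b j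
      /\ forall x : C s, p j (eps x) = epsG (ghom_app (cycle_val (w j)) 0 x).
    by apply: (fun_choice (P := fun j w => HomH_class w = b j
      /\ forall x : C s, p j (eps x) = epsG (ghom_app (cycle_val w) 0 x))).
  have rcc j : represents eps (cc j)
      (fun y : G 0 => eps (ghom_app (cycle_val (c j)) s y)).
    by exists (c j).
  have rcb j : represents eps (HomH_mul (addNr s) (cc j) (b j))
      (fun y : C s => q j (p j (eps y))).
    have [<- wp] := wE j.
    apply: represents_ext
      (represents_mul (addNr s) (w j) s (esym (subrr s)) (rcc j)) _ => y.
    by rewrite cE -wp.
  apply: (represents_eq pC rC (esym (addr0 s)) (represents_sum _ rcb)
    (represents_one eps)) => y.
  apply/ffunP => l; rewrite sum_ffunE (bigD1 l) //= ffunE eqxx.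
  rewrite big1 ?addr0 // => j jl.
  by rewrite ffunE eq_sym (negbTE jl).
exists 'I_r, (fun=> s), b => n x.
exists (fun j => HomH_mul erefl x (cc j)); split.
  rewrite -[LHS](HomH_mul1r (addr0 n)) -cb.
  rewrite HomH_mul_sumr; apply: eq_bigr => j _; symmetry; exact: HomH_mulA.
move=> a xa; apply: functional_extensionality_dep => l.
rewrite xa HomH_mul_suml.
have aE j : HomH_mul erefl (HomH_mul (subrK s n) (a j) (b j)) (cc l) =
    if j == l then a j else 0 :> HomH G G (n - s).
  rewrite (HomH_mulA (subrK s n) erefl (subrr s) (addr0 (n - s))) bc.
  case: eqP => _; first exact: HomH_mul1r.
  exact: (linear0 (mklin (@HomH_mul_linearr R G G G (n - s) 0 (n - s) _ (a j)))).
rewrite (bigD1 l) //= aE eqxx big1 ?addr0 // => j jl.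
by rewrite aE (negbTE jl).
Qed.

Definition residually_minimal (C : chain_complex R) : Prop :=
  forall i j (phi : {linear C j -> kR}) (x : C i),
    phi (ghom_app (cplx_d C) j x) = 0.

(** The augmented coboundary of [u] vanishes: one term because [epsG] kills boundaries of [G], the
    other because maps to k kill those of [C]. Hence a class determines its cochain, and for
    projective [C] Ext in degree n is Hom(C_n, k). *)
Lemma represents_minimal (C : chain_complex R) n (x : HomH C G n) i
    (phi psi : C i -> kR) :
  residually_minimal C -> i = n ->
  represents epsG x phi -> represents epsG x psi -> phi =1 psi.
Proof.
move=> mC ei [z [zx zphi]] [w [wx wpsi]] y; rewrite zphi wpsi.
have /hclassP[u du] : HomH_class z = HomH_class w by rewrite zx wx.
apply/eqP; rewrite -subr_eq0 -linearB.
have -> : ghom_app (cycle_val z) 0 y - ghom_app (cycle_val w) 0 y =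
  ghom_app (hom_d (subrK 1 n) u) 0 y by rewrite du.
rewrite (hom_dE _ _ y (esym (add0r 1)) (esym (subrK 1 i))).
rewrite linearB linearZ_LR /=.
have lin : linear (fun v : C (i - 1) => epsG (ghom_app u 0 v)).
  by move=> a v v'; rewrite !linearP.
have /= -> := mC i (i - 1) (mklin lin) y; rewrite scaler0 subr0.
by apply/eqP; have [_ Ds _] := rG; apply/Ds; exists (ghom_app u 1 y).
Qed.

(** By minimality Ext in degree n is Hom(C_n, k), so exactness is tested on components. It is asked
    for only after Hom(-, k) is applied, so a component map that is invertible merely modulo m will
    do. *)
Lemma ext_short_exact C C' C'' (a : cocycle C C' 0) (b : cocycle C' C'' 0) :
  projective_complex C -> projective_complex C' -> projective_complex C'' ->
  residually_minimal C -> residually_minimal C' -> residually_minimal C'' ->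
  (forall n (phi : {linear C'' n -> kR}),
     (forall y : C' n, phi (ghom_app (cycle_val b) n y) = 0) ->
     forall v, phi v = 0) ->
  (forall n (phi : {linear C' n -> kR}),
     (forall y : C n, phi (ghom_app (cycle_val a) n y) = 0) <->
     exists psi : {linear C'' n -> kR},
       forall y, phi y = psi (ghom_app (cycle_val b) n y)) ->
  (forall n (phi : {linear C n -> kR}), exists psi : {linear C' n -> kR},
     forall y, phi y = psi (ghom_app (cycle_val a) n y)) ->
  short_exact (ext_map (HomH_class b)) (ext_map (HomH_class a)).
Proof.
move=> pC pC' pC'' mC mC' mC'' h1 h2 h3.
have form (D : chain_complex R) (n : int) (x : HomH D G n) :
    exists phi : {linear D n -> kR}, represents epsG x phi.
  by have [phi [? _]] := represents_exists x rG (esym (add0r n)); exists phi.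
have exists_form (D : chain_complex R) (n : int) (phi : {linear D n -> kR}) :
    projective_complex D -> residually_minimal D ->
    exists x : HomH D G n, represents epsG x phi.
  move=> pD mD; apply: (represents_lift pD rG) => [|y|y].
  - by rewrite add0r.
  - exact: sG.
  - exact: mD.
have form_eq (D : chain_complex R) (n : int) (x y : HomH D G n)
    (phi psi : D n -> kR) :
    projective_complex D -> represents epsG x phi -> represents epsG y psi ->
    phi =1 psi -> x = y.
  by move=> pD; apply: (represents_eq pD rG (esym (add0r n))).
have form_map (D D' : chain_complex R) (f : cocycle D D' 0) (n : int)
    (x : HomH D' G n) (phi : D' n -> kR) :
    represents epsG x phi -> represents epsG (ext_map (HomH_class f) n x)
      (fun y : D n => phi (ghom_app (cycle_val f) n y)).
  by move=> r; apply: represents_mul r; rewrite add0r.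
split=> [n x y xy|n y|n x].
- have [phi rx] := form _ _ x; have [psi ry] := form _ _ y.
  apply: (form_eq _ _ _ _ _ _ pC'' rx ry) => v.
  apply/eqP; rewrite -subr_eq0; apply/eqP.
  have lin : linear (fun v => phi v - psi v).
    by move=> c u w; rewrite (linearP phi) (linearP psi) scalerBr opprD addrACA.
  apply: (h1 n (mklin lin)) => w /=.
  have := form_map _ _ b _ _ _ rx; rewrite xy => rx'.
  rewrite (represents_minimal mC' erefl rx' (form_map _ _ b _ _ _ ry) w).
  by rewrite subrr.
- have [phi ry] := form _ _ y; have [psi psiE] := h3 n phi.
  have [x rx] := exists_form _ _ psi pC' mC'; exists x.
  by apply: (form_eq _ _ _ _ _ _ pC (form_map _ _ a _ _ _ rx) ry) => v.
- have [phi rx] := form _ _ x; split=> [ax|[y yx]].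
    have /h2[psi psiE] : forall y : C n, phi (ghom_app (cycle_val a) n y) = 0.
      have := form_map _ _ a _ _ _ rx; rewrite ax => r.
      exact: (represents_minimal mC erefl r (represents0 _ _ _ _)).
    have [y ry] := exists_form _ _ psi pC'' mC''; exists y.
    by apply: (form_eq _ _ _ _ _ _ pC' (form_map _ _ b _ _ _ ry) rx) => v.
  have [psi ry] := form _ _ y.
  apply: (form_eq _ _ _ _ _ _ pC (form_map _ _ a _ _ _ rx)
    (represents0 _ _ _ _)).
  apply/h2; exists psi => w.
  have := form_map _ _ b _ _ _ ry; rewrite yx => r.
  exact: (represents_minimal mC' erefl rx r).
Qed.

End ResidueField.

End ExtModules.

(** * Modules over a local ring *)

Lemma lift_property_row (R : comNzRingType) n : lift_property ('rV[R]_n : lmodType R).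
Proof.
move=> A B g f im.
have [a aE] := fun_choice (P := fun i a => g a = f (delta_mx 0 i))
  (fun i => im (delta_mx 0 i)).
have lin : linear (fun u : 'rV[R]_n => \sum_i u 0 i *: a i).
  move=> c u v; rewrite scaler_sumr -big_split; apply: eq_bigr => i _ /=.
  by rewrite !mxE scalerDl scalerA.
exists (mklin lin) => u /=.
rewrite [in RHS](row_sum_delta u) !linear_sum; apply: eq_bigr => i _.
by rewrite !linearZ_LR aE.
Qed.

Lemma lift_property_prod (R : comNzRingType) (P Q : lmodType R) :
  lift_property P -> lift_property Q -> lift_property ((P * Q)%type : lmodType R).
Proof.
move=> lP lQ A B g f im.
have lin1 : linear (fun u : P => f (u, 0)).
  move=> a u v; rewrite -linearP; congr (f _).
  by rewrite [RHS](_ : _ = (a *: u + v, a *: 0 + 0)) // scaler0 addr0.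
have lin2 : linear (fun u : Q => f (0, u)).
  move=> a u v; rewrite -linearP; congr (f _).
  by rewrite [RHS](_ : _ = (a *: 0 + 0, a *: u + v)) // scaler0 addr0.
have [h1 h1E] := lP A B g (mklin lin1) (fun u => im (u, 0)).
have [h2 h2E] := lQ A B g (mklin lin2) (fun u => im (0, u)).
have lin : linear (fun u : (P * Q)%type => h1 u.1 + h2 u.2).
  by move=> a u v /=; rewrite !linearP scalerDr addrACA.
exists (mklin lin) => -[u v] /=.
rewrite linearD h1E h2E /= -linearD; congr (f _).
by rewrite [LHS](_ : _ = (u + 0, 0 + v)) // addr0 add0r.
Qed.

Lemma lift_property_retract (R : comNzRingType) (P Q : lmodType R)
    (i : {linear Q -> P}) (p : {linear P -> Q}) :
  cancel i p -> lift_property P -> lift_property Q.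
Proof.
move=> ip lP A B g f im.
have linf : linear (fun u => f (p u)) by move=> a u v; rewrite !linearP.
have [h hE] := lP A B g (mklin linf) (fun u => im (p u)).
have linh : linear (fun u => h (i u)) by move=> a u v; rewrite !linearP.
by exists (mklin linh) => u /=; rewrite hE /= ip.
Qed.

(** The basis is an arbitrary set and comes without a coordinate function: coordinates with finite
    support are chosen, and linearity follows by comparing those of [x], [y] and [r *: x + y] on one
    common list. *)
Lemma free_lift_property (R : comNzRingType) (P : lmodType R) :
  free_module P -> lift_property P.
Proof.
move=> [B [gen ind]] M N g f im.
have [a aE] := fun_choice im.
have extend (s u : seq P) (c : P -> R) (V : lmodType R) (w : P -> V) :
    uniq s -> uniq u -> {subset s <= u} ->
    \sum_(b <- s) c b *: w b =
    \sum_(b <- u) (if b \in s then c b else 0) *: w b.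
  move=> us uu su; rewrite [RHS](@bigID _ _ _ _ u (mem s)) /= [X in _ + X]big1 ?addr0.
    rewrite [RHS](eq_bigr (fun b => c b *: w b)) => [|b ->//].
    rewrite -[RHS]big_filter; apply: perm_big; apply: uniq_perm => //.
      exact: filter_uniq.
    by move=> b; rewrite mem_filter; case bs: (b \in s) => //=; rewrite su.
  by move=> b /negbTE->; rewrite scale0r.
have genu x : exists sc : seq P * (P -> R), [/\ uniq sc.1,
    forall b, b \in sc.1 -> B b & x = \sum_(b <- sc.1) sc.2 b *: b].
  have [s [c [sB ->]]] := gen x.
  (* A generating list may repeat elements; the multiplicity is moved into the coefficient. *)
  exists (undup s, fun b => c b *+ count_mem b s) => /=; split.
  - exact: undup_uniq.
  - by move=> b; rewrite mem_undup; apply: sB.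
  - rewrite -[LHS]big_undup_iterop_count; apply: eq_bigr => b _.
    by rewrite -scalerMnl.
have [sc scP] := fun_choice genu.
have lin : linear (fun x => \sum_(b <- (sc x).1) (sc x).2 b *: a b).
  move=> r x y; set z := r *: x + y.
  have [[ux Bx xE] [uy By yE] [uz Bz zE]] := And3 (scP x) (scP y) (scP z).
  set u := undup ((sc x).1 ++ (sc y).1 ++ (sc z).1).
  have uu : uniq u by exact: undup_uniq.
  have Bu b : b \in u -> B b.
    by rewrite mem_undup !mem_cat => /or3P[/Bx|/By|/Bz].
  have ext t : {subset (sc t).1 <= u} -> uniq (sc t).1 ->
      forall (V : lmodType R) (w : P -> V), \sum_(b <- (sc t).1) (sc t).2 b *: w b =
      \sum_(b <- u) (if b \in (sc t).1 then (sc t).2 b else 0) *: w b.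
    by move=> su us V w; apply: extend.
  have sx : {subset (sc x).1 <= u} by move=> b; rewrite mem_undup !mem_cat => ->.
  have sy : {subset (sc y).1 <= u}.
    by move=> b; rewrite mem_undup !mem_cat => ->; rewrite orbT.
  have sz : {subset (sc z).1 <= u}.
    by move=> b; rewrite mem_undup !mem_cat => ->; rewrite !orbT.
  rewrite (ext x) // (ext y) // (ext z) //.
  rewrite scaler_sumr -big_split; apply: eq_big_seq => b bu /=.
  rewrite scalerA -scalerDl; congr (_ *: _).
  apply/eqP; rewrite -subr_eq0; apply/eqP.
  have zE' := etrans zE (ext z sz uz P (fun b => b)).
  have xE' := etrans xE (ext x sx ux P (fun b => b)).
  have yE' := etrans yE (ext y sy uy P (fun b => b)).
  apply: (ind u (fun b => (if b \in (sc z).1 then (sc z).2 b else 0) -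
    (r * (if b \in (sc x).1 then (sc x).2 b else 0) +
      (if b \in (sc y).1 then (sc y).2 b else 0)))) => //.
  apply/eqP; under eq_bigr do rewrite scalerBl scalerDl -scalerA.
  rewrite sumrB big_split -scaler_sumr /= -zE' -xE' -yE'.
  by rewrite subrr.
exists (mklin lin) => x /=.
have [_ _ {3}->] := scP x.
by rewrite !linear_sum; apply: eq_bigr => b _; rewrite !linearZ_LR aE.
Qed.

Lemma finite_module_row (R : comNzRingType) n :
  finite_module ('rV[R]_n : lmodType R).
Proof.
exists n, (fun i => delta_mx 0 i) => u; exists (fun i => u 0 i).
exact: row_sum_delta.
Qed.

(** * Submodules as predicates, and their generators *)

Section Generators.
Variables (R : comNzRingType) (V : lmodType R).
Implicit Types S : V -> Prop.

Definition submodule S := S 0 /\ forall a u v, S u -> S v -> S (a *: u + v).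

Definition generated S n (b : 'I_n -> V) :=
  forall v, S v <-> exists c : 'I_n -> R, v = \sum_i c i *: b i.

Definition finitely_generated S := exists n (b : 'I_n -> V), generated S b.

Lemma submodule_sum S n (b : 'I_n -> V) (c : 'I_n -> R) :
  submodule S -> (forall i, S (b i)) -> S (\sum_i c i *: b i).
Proof.
move=> [S0 SD] Sb; elim/big_ind: _ => // [u v Su Sv|i _].
  by rewrite -[u]scale1r; apply: SD.
by rewrite -[_ *: _]addr0; apply: SD.
Qed.

Lemma submoduleB S u v : submodule S -> S u -> S v -> S (u - v).
Proof. by move=> [_ SD] Su Sv; rewrite addrC -scaleN1r; apply: SD. Qed.

Lemma submoduleD S u v : submodule S -> S u -> S v -> S (u + v).
Proof. by move=> [_ SD] Su Sv; rewrite -[u]scale1r; apply: SD. Qed.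

Lemma submoduleZ S a u : submodule S -> S u -> S (a *: u).
Proof. by move=> [S0 SD] Su; rewrite -[_ *: _]addr0; apply: SD. Qed.

Lemma generated_mem S n (b : 'I_n -> V) i : generated S b -> S (b i).
Proof.
move=> Sb; apply/Sb; exists (fun j => (j == i)%:R).
rewrite (bigD1 i) //= eqxx scale1r big1 ?addr0 // => j /negbTE->.
by rewrite scale0r.
Qed.

(** Induction on the number of generators: the coefficients of [b ord0] in elements of [S] form an
    ideal, finitely many elements of [S] realize its generators, and what remains lies in the span
    of the other [b i]. *)
Lemma noetherian_submodule n (b : 'I_n -> V) S :
  noetherian R -> submodule S ->
  (forall v, S v -> exists c : 'I_n -> R, v = \sum_i c i *: b i) ->
  finitely_generated S.
Proof.
move=> nR; elim: n b S => [|n IHn] b S sS Sb.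
  exists 0%N, (fun=> 0) => v; split=> [/Sb[c ->]|[c ->]].
    by exists c; rewrite !big_ord0.
  by rewrite big_ord0; case: sS.
pose span v := exists c : 'I_n -> R, v = \sum_i c i *: b (lift ord0 i).
have sspan : submodule span.
  split; first by exists (fun=> 0); rewrite big1 // => i _; rewrite scale0r.
  move=> a u v [c ->] [d ->]; exists (fun i => a * c i + d i).
  by rewrite scaler_sumr -big_split; apply: eq_bigr => i _; rewrite /= scalerDl scalerA.
pose I r := exists2 v, span v & S (r *: b ord0 + v).
have iI : ideal I.
  split=> [|r t [v sv Sv] [w sw Sw]|r t [v sv Sv]].
  - by exists 0; [case: sspan|rewrite scale0r addr0; case: sS].
  - exists (v + w); first exact: submoduleD.
    by rewrite scalerDl addrACA; apply: submoduleD.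
  - exists (r *: v); first exact: submoduleZ.
    by rewrite -scalerA -scalerDr; apply: submoduleZ.
have [p [g gI]] := nR I iI.
have Ig i : I (g i).
  apply/gI; exists (fun j => (j == i)%:R).
  by rewrite (bigD1 i) //= eqxx mul1r big1 ?addr0 // => j /negbTE->; rewrite mul0r.
have [w wE] : exists w : 'I_p -> V, forall i, span (w i) /\ S (g i *: b ord0 + w i).
  apply: (fun_choice (P := fun i v => span v /\ S (g i *: b ord0 + v))) => i.
  by have [v ? ?] := Ig i; exists v.
have [||q [h hS]] := IHn (fun i => b (lift ord0 i)) (fun v => S v /\ span v).
- split; first by split; [case: sS|case: sspan].
  by move=> a u v [Su su] [Sv sv]; split; [case: sS => _|case: sspan => _]; apply.
- by move=> v [].
have Sh i : S (h i) by have [] := generated_mem i hS.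
pose t (i : 'I_p) := g i *: b ord0 + w i.
exists (p + q)%N, (fun i => match split i with inl i => t i | inr i => h i end).
have sumE (c : 'I_(p + q) -> R) :
    \sum_i c i *: match split i with inl i => t i | inr i => h i end =
    \sum_i c (lshift q i) *: t i + \sum_i c (rshift p i) *: h i.
  rewrite big_split_ord; congr (_ + _); apply: eq_bigr => i _.
    by rewrite (unsplitK (inl i)).
  by rewrite (unsplitK (inr i)).
move=> v; split=> [Sv|[c ->]]; last first.
  rewrite sumE; apply: submoduleD => //; apply: submodule_sum => // i.
  exact: (wE i).2.
have [c vE] := Sb v Sv; rewrite big_ord_recl in vE.
have /gI[d dE] : I (c ord0).
  exists (\sum_i c (lift ord0 i) *: b (lift ord0 i)); last by rewrite -vE.
  by exists (fun i => c (lift ord0 i)).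
have /hS[e eE] : S (v - \sum_i d i *: t i) /\ span (v - \sum_i d i *: t i).
  split.
    by apply: submoduleB => //; apply: submodule_sum => // i; exact: (wE i).2.
  have -> : \sum_i d i *: t i = c ord0 *: b ord0 + \sum_i d i *: w i.
    rewrite dE scaler_suml -big_split; apply: eq_bigr => i _ /=.
    by rewrite scalerDr scalerA.
  rewrite vE opprD addrACA subrr add0r; apply: submoduleB => //.
    by exists (fun i => c (lift ord0 i)).
  by apply: submodule_sum => // i; exact: (wE i).1.
exists (fun i => match split i with inl i => d i | inr i => e i end).
rewrite sumE.
under eq_bigr do rewrite (unsplitK (inl _)).
under [X in _ = _ + X]eq_bigr do rewrite (unsplitK (inr _)).
by rewrite -eE addrC subrK.
Qed.

Lemma finite_submodule S : noetherian R -> finite_module V -> submodule S ->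
  finitely_generated S.
Proof. by move=> nR [n [b bV]] sS; apply: (noetherian_submodule (b := b)). Qed.

End Generators.

Section Local.
Variables (R : comNzRingType) (k : fieldType) (pi : {rmorphism R -> k}).
Local Notation kR := (resmod pi).
Hypothesis nR : noetherian R.
Hypothesis pis : forall y : k, exists r : R, pi r = y.
Hypothesis unitR : forall r, pi r <> 0 -> exists s, s * r = 1.

Section MaximalIdealMultiples.
Variable V : lmodType R.
Implicit Types S : V -> Prop.

(* The submodule m S, for m = ker pi. *)
Inductive mmul S : V -> Prop :=
| mmul0 : mmul S 0
| mmulD u v : mmul S u -> mmul S v -> mmul S (u + v)
| mmulM a w : pi a = 0 -> S w -> mmul S (a *: w).

Lemma mmulZ S r v : mmul S v -> mmul S (r *: v).
Proof.
elim=> [|u w _ mu _ mw|a w a0 Sw]; first by rewrite scaler0; apply: mmul0.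
  by rewrite scalerDr; apply: mmulD.
by rewrite scalerA; apply: mmulM; rewrite // rmorphM a0 mulr0.
Qed.

Lemma submodule_mmul S : submodule (mmul S).
Proof.
split; first exact: mmul0.
by move=> a u v mu mv; apply: mmulD => //; apply: mmulZ.
Qed.

Lemma mmul_mono S S' v : (forall w, S w -> S' w) -> mmul S v -> mmul S' v.
Proof.
move=> SS'; elim=> [|u w _ mu _ mw|a w a0 Sw]; first exact: mmul0.
  exact: mmulD.
by apply: mmulM; last exact: SS'.
Qed.

Definition all_elements (v : V) := True.

Lemma submodule_all : submodule all_elements.
Proof. by []. Qed.

Definition minimally_generated S n (b : 'I_n -> V) :=
  generated S b /\
  forall c : 'I_n -> R, \sum_i c i *: b i = 0 -> forall i, pi (c i) = 0.

(** Take the least number of generators: a relation with a coefficient outside [ker pi], a unit by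
    locality, would express one generator through the others. *)
Lemma minimal_generators S : finitely_generated S ->
  exists n (b : 'I_n -> V), minimally_generated S b.
Proof.
move=> [n0 [b0 b0S]].
pose P n := `[< exists b : 'I_n -> V, generated S b >].
have exP : exists n, P n by exists n0; apply/asboolP; exists b0.
case: (ex_minnP exP) => n /asboolP[b bS] nmin.
exists n, b; split=> // c c0 j; apply: contrapT => /unitR[s sE].
case: n b bS nmin c c0 j sE => [|n] b bS nmin c c0 j sE; first by case: j sE.
have /nmin : P n; last by rewrite ltnn.
apply/asboolP; exists (fun i => b (lift j i)) => v.
have bj : b j = \sum_i (- (s * c (lift j i))) *: b (lift j i).
  move: c0; rewrite (bigD1_ord j) //= => /eqP; rewrite addr_eq0 => /eqP.
  move=> /(congr1 ( *:%R s)); rewrite scalerA sE scale1r => ->.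
  rewrite scalerN scaler_sumr -sumrN; apply: eq_bigr => i _.
  by rewrite scalerA scaleNr.
split=> [/bS[d ->]|[d ->]].
  exists (fun i => d j * (- (s * c (lift j i))) + d (lift j i)).
  rewrite (bigD1_ord j) //= bj scaler_sumr -big_split; apply: eq_bigr => i _ /=.
  by rewrite scalerDl scalerA.
have sS : submodule S.
  split; first by apply/bS; exists (fun=> 0); rewrite big1 // => i _; rewrite scale0r.
  move=> a u w /bS[e ->] /bS[f ->]; apply/bS; exists (fun i => a * e i + f i).
  by rewrite scaler_sumr -big_split; apply: eq_bigr => i _; rewrite /= scalerDl scalerA.
by apply: submodule_sum => // i; apply: generated_mem bS.
Qed.

Lemma linear_form_mmul (W : lmodType R) (phi : {linear V -> W}) S v :
  (forall a w, pi a = 0 -> S w -> a *: phi w = 0) -> mmul S v -> phi v = 0.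
Proof.
move=> phi0; elim=> [|u w _ pu _ pw|a w a0 Sw]; first exact: linear0.
  by rewrite linearD pu pw addr0.
by rewrite linearZ_LR phi0.
Qed.

Lemma linear_form_residue r (phi : {linear V -> {ffun 'I_r -> kR}}) S v :
  mmul S v -> phi v = 0.
Proof.
apply: linear_form_mmul => a w a0 _; apply/ffunP => i; rewrite !ffunE.
by rewrite [LHS](_ : _ = pi a * (phi w i : k)) // a0 mul0r.
Qed.

Lemma linear_form_residue1 (phi : {linear V -> kR}) S v :
  mmul S v -> phi v = 0.
Proof.
apply: linear_form_mmul => a w a0 _.
by rewrite [LHS](_ : _ = pi a * (phi w : k)) // a0 mul0r.
Qed.

(** Coordinates along minimal generators are unique modulo m, so reducing them gives V -> V / m V as
    a map onto k^n, with no quotient module formed. *)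
Lemma residue_quotient : finite_module V ->
  exists n (q : {linear V -> {ffun 'I_n -> kR}}),
    (forall y, exists x, q x = y) /\
    forall v, q v = 0 <-> mmul all_elements v.
Proof.
move=> fV; have fg : finitely_generated all_elements.
  by apply: finite_submodule submodule_all.
have [n [b [bV bmin]]] := minimal_generators fg; exists n.
have [c cE] : exists c : V -> 'I_n -> R, forall v, v = \sum_i c v i *: b i.
  by apply: (fun_choice (P := fun v c => v = \sum_i c i *: b i)) => v; apply/bV.
have cU v d : v = \sum_i d i *: b i -> forall i, pi (c v i) = pi (d i).
  move=> vd i; apply/eqP; rewrite -subr_eq0 -rmorphB; apply/eqP.
  apply: (bmin (fun i => c v i - d i)).
  under eq_bigr do rewrite scalerBl.
  by rewrite sumrB -cE -vd subrr.
have lin : linear (fun v => [ffun i => pi (c v i) : kR]).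
  move=> a u v; apply/ffunP => i; rewrite !ffunE.
  rewrite (cU _ (fun i => a * c u i + c v i)) ?rmorphD ?rmorphM //.
  rewrite {1}(cE u) {1}(cE v) scaler_sumr -big_split; apply: eq_bigr => j _ /=.
  by rewrite scalerDl scalerA.
exists (mklin lin); split=> [y|v].
  have [r rE] := fun_choice (fun i : 'I_n => pis (y i)).
  exists (\sum_i r i *: b i); apply/ffunP => i; rewrite ffunE.
  by rewrite (cU _ r) // rE.
split=> [/ffunP v0|]; last exact: linear_form_residue.
rewrite (cE v); elim/big_ind: _ => [|u w|i _]; [exact: mmul0|exact: mmulD|].
by apply: mmulM => //; have := v0 i; rewrite !ffunE.
Qed.

(** A module killed by m is a vector space: scalars of k act through a chosen section [l] of [pi],
    which respects sums and products only modulo m, and m kills [S]. *)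
Lemma residue_embedding S : finitely_generated S ->
  (forall a w, pi a = 0 -> S w -> a *: w = 0) ->
  exists r (i : {linear {ffun 'I_r -> kR} -> V}),
    injective i /\ forall v, S v <-> exists c, i c = v.
Proof.
move=> fg mS; have [n [b [bS bmin]]] := minimal_generators fg; exists n.
have [l lE] := fun_choice pis.
have Sb i : S (b i) by exact: generated_mem bS.
have cU (c d : 'I_n -> R) : (forall i, pi (c i) = pi (d i)) ->
    \sum_i c i *: b i = \sum_i d i *: b i.
  move=> cd; apply: eq_bigr => i _; apply/eqP.
  by rewrite -subr_eq0 -scalerBl mS // rmorphB cd subrr.
have lin : linear (fun c : {ffun 'I_n -> kR} => \sum_i l (c i) *: b i).
  move=> a c d; rewrite scaler_sumr -big_split /=.
  under [RHS]eq_bigr do rewrite scalerA -scalerDl.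
  apply: cU => i; rewrite rmorphD rmorphM !lE !ffunE.
  by [].
exists (mklin lin); split=> [|v].
  apply: raddf_inj => c /= c0; apply/ffunP => i; rewrite ffunE.
  by rewrite -[LHS]lE; apply: (bmin _ c0).
split=> [/bS[d ->]|[c <-]].
  exists [ffun i => pi (d i) : kR]; apply: cU => i.
  by rewrite lE ffunE.
by apply/bS; exists (fun i => l (c i)).
Qed.

Lemma minimal_cover : finite_module V ->
  exists n (e : {linear 'rV[R]_n -> V}), (forall v, exists u, e u = v) /\
    forall u, e u = 0 -> forall i, pi (u 0 i) = 0.
Proof.
move=> fV; have fg : finitely_generated all_elements.
  by apply: finite_submodule submodule_all.
have [n [b [bV bmin]]] := minimal_generators fg; exists n.
have lin : linear (fun u : 'rV[R]_n => \sum_i u 0 i *: b i).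
  move=> a u v; rewrite scaler_sumr -big_split; apply: eq_bigr => i _.
  by rewrite !mxE /= scalerDl scalerA.
exists (mklin lin); split=> [v|u]; last exact: bmin.
have [c ->] := (bV v).1 I.
exists (\row_i c i); apply: eq_bigr => i _.
by rewrite mxE.
Qed.

End MaximalIdealMultiples.

Lemma mmul_image (V W : lmodType R) (f : {linear V -> W}) (S : V -> Prop)
    (T : W -> Prop) v :
  (forall w, S w -> T (f w)) -> mmul S v -> mmul T (f v).
Proof.
move=> ST; elim=> [|u w _ mu _ mw|a w a0 Sw]; rewrite ?linear0; first exact: mmul0.
  by rewrite linearD; apply: mmulD.
by rewrite linearZ_LR; apply: mmulM => //; apply: ST.
Qed.

Lemma mmul_lift (V W : lmodType R) (f : {linear V -> W}) (S : V -> Prop)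
    (T : W -> Prop) w :
  (forall w, T w -> exists2 v, S v & f v = w) -> mmul T w ->
  exists2 v, mmul S v & f v = w.
Proof.
move=> TS; elim=> [|u w' _ [v mv <-] _ [v' mv' <-]|a w' a0 /TS[v Sv <-]].
- by exists 0; [exact: mmul0|exact: linear0].
- by exists (v + v'); [exact: mmulD|exact: linearD].
- by exists (a *: v); [exact: mmulM|exact: linearZ_LR].
Qed.

(** The rows of [B] are minimal generators of the kernel, so their relations have coefficients in m.
    A kernel covered by a matrix is again the input for the next matrix. *)
Lemma kernel_cover n (W : lmodType R) (e : {linear 'rV[R]_n -> W}) :
  exists r (B : 'M[R]_(r, n)),
    (forall u, e u = 0 <-> exists w, w *m B = u) /\
    forall w : 'rV_r, w *m B = 0 -> forall i, pi (w 0 i) = 0.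
Proof.
have sK : submodule (fun u => e u = 0).
  split; first exact: linear0.
  by move=> a u v u0 v0; rewrite linearP u0 v0 scaler0 addr0.
have [r [b [bK bmin]]] :=
  minimal_generators (finite_submodule nR (finite_module_row R n) sK).
have bE (w : 'rV_r) : w *m (\matrix_i b i) = \sum_i w 0 i *: b i.
  by rewrite mulmx_sum_row; apply: eq_bigr => i _; rewrite rowK.
exists r, (\matrix_i b i); split=> [u|w]; last by rewrite bE => /bmin.
split=> [/bK[c ->]|[w <-]]; last by apply/bK; exists (fun i => w 0 i).
exists (\row_i c i); rewrite bE; apply: eq_bigr => i _.
by rewrite mxE.
Qed.

End Local.

(** * Minimal resolutions *)

Section NatComplex.
Variables (R : comNzRingType) (s : int) (C : nat -> lmodType R).
Variable delta : forall n, {linear C n.+1 -> C n}.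
Hypothesis delta_delta : forall n x, delta n (delta n.+1 x) = 0.

Definition nat_comp (z : int) : lmodType R :=
  if z is Posz n then C n else 'rV[R]_0.

Definition nat_d (z w : int) : nat_comp z -> nat_comp w :=
  match z, w with
  | Posz p, Posz q => fun x =>
      if @eqP _ p q.+1 is ReflectT e then delta q (eq_rect p C x q.+1 e) else 0
  | _, _ => fun _ => 0
  end.

Fact nat_d_linear z w : linear (@nat_d z w).
Proof.
case: z w => [p|p] [q|q] a x y //=; try by rewrite scaler0 addr0.
case: eqP => [e|_]; last by rewrite scaler0 addr0.
by subst p; rewrite linearP.
Qed.

Lemma nat_dE n x : @nat_d (Posz n.+1) (Posz n) x = delta n x.
Proof. by rewrite /=; case: eqP => // e; rewrite (Prop_irrelevance e erefl). Qed.

Lemma nat_d0 z w x : z != w + 1 -> @nat_d z w x = 0.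
Proof.
by case: z w x => [p|p] [q|q] x //= /eqP ne; case: eqP => // e; lia.
Qed.

Lemma nat_dd z w v x : @nat_d w v (@nat_d z w x) = 0.
Proof.
have lin0 u t : @nat_d u t 0 = 0 := linear0 (mklin (@nat_d_linear u t)).
have [zw|ne] := eqVneq z (w + 1); last by rewrite (nat_d0 x ne) lin0.
have [wv|ne] := eqVneq w (v + 1); last exact: nat_d0.
case: v wv => [n|n] wv; last by move: (@nat_d z w x); case: w {x zw} wv.
have ew : w = Posz n.+1 by lia.
have ez : z = Posz n.+2 by lia.
by clear zw wv; subst w z; rewrite !nat_dE delta_delta.
Qed.

Lemma nat_exact z w v x : (forall n x, delta n x = 0 -> exists y, delta n.+1 y = x) ->
  z = w + 1 -> w = v + 1 -> (0 < w)%R -> @nat_d w v x = 0 ->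
  exists y, @nat_d z w y = x.
Proof.
move=> ex zw wv w0.
case: v wv => [n|n] wv; last by lia.
have ew : w = Posz n.+1 by lia.
have ez : z = Posz n.+2 by lia.
by clear zw wv w0; subst w z; rewrite nat_dE => /ex[y yE]; exists y; rewrite nat_dE.
Qed.

Definition nat_ghom : ghom (fun i => nat_comp (i - s)) (fun i => nat_comp (i - s)) 1.
Proof.
exists (fun i j x => @nat_d (i - s) (j - s) x) => [i j|i j x ne].
  exact: nat_d_linear.
by apply: nat_d0; apply: contra_neq ne; lia.
Defined.

Definition nat_complex : chain_complex R.
Proof.
exists (fun i => nat_comp (i - s)) nat_ghom.
apply: ghomP => i j x; rewrite (ghom_compE _ _ _ _ _ (esym (subrK 1 i))).
exact: nat_dd.
Defined.

Section Augmentation.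
Variables (N : lmodType R) (aug : {linear C 0%N -> N}).

Definition nat_aug (z : int) : nat_comp z -> N :=
  if z is Posz 0%N then aug else fun=> 0.

Fact nat_aug_linear z : linear (@nat_aug z).
Proof.
by case: z => [[|n]|n] a x y /=; rewrite ?linearP // scaler0 addr0.
Qed.

Definition nat_complex_aug : {linear nat_complex s -> N} :=
  mklin (@nat_aug_linear (s - s)).

Lemma nat_complex_aug_surj : (forall y, exists x, aug x = y) ->
  forall y, exists x, nat_complex_aug x = y.
Proof.
move=> surj y; rewrite /nat_complex_aug /=; have [x <-] := surj y.
have : exists x' : nat_comp (Posz 0), nat_aug x' = aug x by exists x.
by move: (s - s) (subrr s) => z ->.
Qed.

Lemma nat_complex_resolves :
  (forall x, aug x = 0 <-> exists y, delta 0%N y = x) ->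
  (forall n x, delta n x = 0 -> exists y, delta n.+1 y = x) ->
  resolves nat_complex_aug.
Proof.
move=> ex0 ex; split.
- move=> i x lt; rewrite /= in x *.
  by move: x; case E: (i - s) => [n|n] x; [lia|apply/rowP; case].
- rewrite /= /ghom_app /=.
  have : s - s = Posz 0 by rewrite subrr.
  have : s + 1 - s = Posz 1 by lia.
  move: (s - s) (s + 1 - s) => z w -> -> x.
  by split=> [/ex0[y yE]|[y]]; [exists y|]; rewrite nat_dE // => yE; apply/ex0; exists y.
- move=> i j l x ij jl sj; rewrite /ghom_app /=.
  by apply: nat_exact => //; lia.
Qed.
End Augmentation.

End NatComplex.

Section MinimalResolution.
Variables (R : comNzRingType) (k : fieldType) (pi : {rmorphism R -> k}).
Hypothesis nR : noetherian R.
Hypothesis unitR : forall r, pi r <> 0 -> exists s, s * r = 1.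

Definition minimal_complex (C : chain_complex R) : Prop :=
  forall i j (x : C i),
    mmul pi (@all_elements R (C j)) (ghom_app (cplx_d C) j x).

Definition finite_complex (C : chain_complex R) : Prop :=
  forall i, finite_module (C i).

Lemma minimal_residually (C : chain_complex R) :
  minimal_complex C -> residually_minimal pi C.
Proof. by move=> mC i j phi x; apply: linear_form_residue1 (mC i j x). Qed.

(** The sizes of the syzygy matrices are found only along the way; packed with the matrix they give
    one type on which building a resolution is an iteration. *)
Record mx_state := MxState
  { st_rows : nat; st_cols : nat; st_mx : 'M[R]_(st_rows, st_cols) }.

Lemma row_mmul n (u : 'rV[R]_n) : (forall i, pi (u 0 i) = 0) ->
  mmul pi (@all_elements R 'rV[R]_n) u.
Proof.
move=> u0; rewrite (row_sum_delta u).
elim/big_ind: _ => [|v w|i _]; [exact: mmul0|exact: mmulD|].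
exact: mmulM.
Qed.

(** Each differential is a matrix whose rows minimally generate the previous kernel. The image of
    the next one consists of relations among these rows, hence has coordinates in m. *)
Lemma minimal_resolution s (N : lmodType R) : finite_module N ->
  exists (C : chain_complex R) (eps : {linear C s -> N}),
    [/\ projective_complex C, resolves eps, forall y, exists x, eps x = y,
        minimal_complex C & finite_complex C].
Proof.
move=> fN; have [n0 [e [es emin]]] := minimal_cover nR unitR fN.
have [r0 [b [bK bmin]]] := kernel_cover nR unitR e.
have [nr [nB nBP]] : exists (nr : mx_state -> nat)
    (nB : forall st, 'M[R]_(nr st, st_rows st)), forall st,
    (forall u : 'rV_(st_rows st), u *m st_mx st = 0 <-> exists w, w *m nB st = u) /\
    forall w : 'rV_(nr st), w *m nB st = 0 -> forall i, pi (w 0 i) = 0.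
  have lin (st : mx_state) : linear (fun u : 'rV_(st_rows st) => u *m st_mx st).
    by move=> a u v; rewrite mulmxDl -scalemxAl.
  pose cov st := cid (kernel_cover nR unitR (mklin (lin st))).
  exists (fun st => sval (cov st)), (fun st => sval (cid (svalP (cov st)))).
  by move=> st; exact: svalP (cid (svalP (cov st))).
pose next st := MxState (nB st).
pose st n := iter n next (MxState b).
pose C n : lmodType R := 'rV[R]_(st_cols (st n)).
have lin n : linear (fun u : C n.+1 => u *m st_mx (st n) : C n).
  by move=> a u v; rewrite mulmxDl -scalemxAl.
pose delta n := mklin (@lin n).
have stP n : (forall u : C n.+1, delta n u = 0 <-> exists w, delta n.+1 w = u) /\
    forall w : C n.+2, delta n.+1 w = 0 -> forall i, pi (w 0 i) = 0.
  exact: (nBP (st n)).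
have dd n x : delta n (delta n.+1 x) = 0 by apply/(stP n).1; exists x.
have min0 (x : C 1%N) : delta 0%N x = 0 -> forall i, pi (x 0 i) = 0.
  exact: bmin.
have dmin n (x : C n.+1) : forall i, pi (delta n x 0 i) = 0.
  case: n x => [|n] x.
    by apply: emin; apply/bK; exists x.
  case: n x => [|n] x; first by apply: min0; rewrite dd.
  by apply: (stP n).2; rewrite dd.
exists (nat_complex s dd), (nat_complex_aug s dd (e : {linear C 0%N -> N})); split.
- move=> i; rewrite /= /nat_comp.
  by case: (i - s) => n; apply: lift_property_row.
- apply: nat_complex_resolves => [x|n x]; first exact: bK.
  by move/(stP n).1.
- exact: nat_complex_aug_surj.
- suff min z w (x : nat_comp C z) :
      mmul pi (@all_elements R (nat_comp C w)) (nat_d delta w x).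
    by move=> i j x; apply: (min (i - s) (j - s) x).
  have [zw|ne] := eqVneq z (w + 1); last by rewrite nat_d0 //; apply: mmul0.
  case: w zw => [n|n] zw.
    have ez : z = Posz n.+1 by lia.
    by clear zw; subst z; rewrite nat_dE; apply: row_mmul; apply: dmin.
  by apply: row_mmul => -[].
- move=> i; rewrite /= /nat_comp.
  by case: (i - s) => n; apply: finite_module_row.
Qed.

End MinimalResolution.

(** * Truncations and cones *)

Section ChainMaps.
Variable R : comNzRingType.
Implicit Types C D : chain_complex R.

Definition ghom0 C D (h : forall i, {linear C i -> D i}) : ghom C D 0.
Proof.
exists (fun i j x =>
  if @eqP _ i j is ReflectT e then eq_rect i (fun t => D t) (h i x) j e else 0).
  move=> i j a x y; case: eqP => [e|_]; last by rewrite scaler0 addr0.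
  by case: _ / e; rewrite linearP.
by move=> i j x; rewrite addr0; case: eqP.
Defined.

Lemma ghom0E C D (h : forall i, {linear C i -> D i}) i x :
  ghom_app (ghom0 h) i x = h i x.
Proof.
by rewrite /ghom_app /=; case: eqP => // e; rewrite (Prop_irrelevance e erefl).
Qed.

Lemma chain_map C D (h : forall i, {linear C i -> D i}) :
  (forall i (x : C (i + 1)),
     ghom_app (cplx_d D) i (h _ x) = h _ (ghom_app (cplx_d C) i x)) ->
  exists a : cocycle C D 0, forall i x, ghom_app (cycle_val a) i x = h i x.
Proof.
move=> hd.
have zh : ghom0 h \in cycle_pred (hom_d (erefl (0 + 1))).
  apply/eqP; apply: ghomP => i j x /=.
  have [e|ne] := eqVneq i (j + 1); last by rewrite !ghom_app0.
  subst i; rewrite (hom_dE _ _ x (erefl (j + 1)) (erefl (j + 1))).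
  by rewrite expr0 scale1r !ghom0E hd subrr.
by exists (Cycle zh : cocycle C D 0) => i x; apply: ghom0E.
Qed.

Lemma cocycle1_d C D (f : cocycle C D 1) i j l (x : C i) :
  ghom_app (cplx_d D) l (ghom_app (cycle_val f) j x) +
  ghom_app (cycle_val f) l (ghom_app (cplx_d C) j x) = 0.
Proof.
have [ij|ij] := eqVneq i (j + 1); last first.
  by rewrite !(ghom_app0 _ x ij) !linear0 addr0.
have [jl|jl] := eqVneq j (l + 1); last by rewrite !(ghom_app0 _ _ jl) addr0.
have := congr1 (fun w => ghom_app w l x) (cocycleP erefl f).
by rewrite (hom_dE _ _ x jl ij) expr1 scaleN1r opprK.
Qed.

End ChainMaps.

Section Truncation.
Variable R : comNzRingType.

Definition keep (b : bool) (V : lmodType R) : lmodType R :=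
  if b then V else 'rV[R]_0.
Definition keep_in_fun b (V : lmodType R) : V -> keep b V :=
  if b is true then id else fun=> 0.
Definition keep_out_fun b (V : lmodType R) : keep b V -> V :=
  if b is true then id else fun=> 0.

Fact keep_in_linear b (V : lmodType R) : linear (@keep_in_fun b V).
Proof. by case: b => a u v //=; rewrite scaler0 addr0. Qed.
Fact keep_out_linear b (V : lmodType R) : linear (@keep_out_fun b V).
Proof. by case: b => a u v //=; rewrite scaler0 addr0. Qed.

Definition keep_in b (V : lmodType R) : {linear V -> keep b V} :=
  mklin (@keep_in_linear b V).
Definition keep_out b (V : lmodType R) : {linear keep b V -> V} :=
  mklin (@keep_out_linear b V).

Lemma keep_outK b (V : lmodType R) : cancel (keep_out b V) (keep_in b V).
Proof. by case: b => x //=; apply/rowP; case. Qed.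
Lemma keep_inK (b : bool) (V : lmodType R) : b -> cancel (keep_in b V) (keep_out b V).
Proof. by case: b. Qed.
Lemma keep0 (b : bool) (V : lmodType R) (x : keep b V) : ~~ b -> x = 0.
Proof. by case: b x => // x _; apply/rowP; case. Qed.

Variables (b : int -> bool) (C : chain_complex R).

Definition trunc_ghom :
  ghom (fun i => keep (b i) (C i)) (fun i => keep (b i) (C i)) 1.
Proof.
exists (fun i j x =>
    keep_in (b j) _ (ghom_app (cplx_d C) j (keep_out (b i) _ x))).
  by move=> i j a x y; rewrite !linearP.
by move=> i j x ne; rewrite ghom_app0 ?linear0.
Defined.

(** Any set [b] of degrees gives a complex: two consecutive differentials either compose as in [C]
    or pass through a zero component. *)
Definition trunc : chain_complex R.
Proof.
exists (fun i => keep (b i) (C i)) trunc_ghom.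
apply: ghomP => i j x; rewrite (ghom_compE _ _ _ _ _ (esym (subrK 1 i))).
change (keep_in (b j) _ (ghom_app (cplx_d C) j (keep_out (b (i - 1)) _
  (keep_in (b (i - 1)) _ (ghom_app (cplx_d C) (i - 1) (keep_out (b i) _ x))))) = 0).
case: (orP (orbN (b (i - 1)))) => [bi|nb].
  by rewrite (keep_inK bi) cplx_ddE linear0.
by rewrite [X in keep_out _ _ X](keep0 _ nb) !linear0.
Defined.

Lemma trunc_dE i j (x : trunc i) : ghom_app (cplx_d trunc) j x =
  keep_in (b j) _ (ghom_app (cplx_d C) j (keep_out (b i) _ x)).
Proof. by []. Qed.

Lemma trunc_projective : projective_complex C -> projective_complex trunc.
Proof.
move=> pC i; apply: (lift_property_retract _ (pC i)).
exact: (@keep_outK (b i) (C i)).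
Qed.

Lemma finite_module_image (V W : lmodType R) (f : {linear V -> W}) :
  (forall w, exists v, f v = w) -> finite_module V -> finite_module W.
Proof.
move=> fs [n [g gV]]; exists n, (fun i => f (g i)) => w.
have [v <-] := fs w; have [c ->] := gV v; exists c.
by rewrite linear_sum; apply: eq_bigr => i _; rewrite linearZ_LR.
Qed.

Lemma trunc_finite : finite_complex C -> finite_complex trunc.
Proof.
move=> fC i; apply: (finite_module_image (f := keep_in (b i) (C i))) => // w.
by exists (keep_out (b i) _ w); apply: keep_outK.
Qed.

Lemma trunc_minimal (k : fieldType) (pi : {rmorphism R -> k}) :
  minimal_complex pi C -> minimal_complex pi trunc.
Proof.
by move=> mC i j x; rewrite trunc_dE; apply: mmul_image (mC _ _ _).
Qed.

End Truncation.

Section TruncationResolves.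
Variables (R : comNzRingType) (C : chain_complex R) (s : int) (N : lmodType R).
Variable eps : {linear C s -> N}.
Hypothesis rC : resolves eps.

Definition trunc_ge t := trunc (fun i => (t <= i)%R) C.

Lemma trunc_ge_exact t i j l (x : trunc_ge t j) : i = j + 1 -> j = l + 1 ->
  (s < j)%R -> (t < j)%R -> ghom_app (cplx_d (trunc_ge t)) l x = 0 ->
  exists y : trunc_ge t i, ghom_app (cplx_d (trunc_ge t)) j y = x.
Proof.
have [_ _ Cex] := rC.
move=> ij jl sj tj; rewrite trunc_dE => /(congr1 (keep_out _ _)).
rewrite keep_inK ?linear0; last by lia.
move=> /(Cex _ _ _ _ ij jl sj)[y yE]; exists (keep_in _ _ y).
by rewrite trunc_dE keep_inK ?yE ?keep_outK //; lia.
Qed.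

(** The truncation resolves a syzygy, presented as the image of the differential into [C l] rather
    than as a module of its own. *)
Lemma trunc_ge_resolves t l : t = l + 1 -> (s < t)%R ->
  exists eps' : {linear trunc_ge t t -> C l}, resolves eps' /\
    forall x, eps' x = ghom_app (cplx_d C) l (keep_out _ _ x).
Proof.
have [_ _ Cex] := rC => tl st.
have lin : linear (fun x : trunc_ge t t =>
    ghom_app (cplx_d C) l (keep_out (t <= t)%R (C t) x)).
  by move=> a x y; rewrite !linearP.
exists (mklin lin); split=> //; split=> [i x lt|x|i j l' x ij jl tj].
- by apply: keep0; rewrite -ltNge.
- rewrite [mklin lin x](_ : _ = ghom_app (cplx_d C) l (keep_out _ _ x)) //.
  split=> [/(Cex _ _ _ _ (erefl (t + 1)) tl st)[y yE]|[y <-]].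
    exists (keep_in _ _ y).
    by rewrite trunc_dE keep_inK ?yE ?keep_outK //; lia.
  by rewrite trunc_dE keep_inK ?cplx_ddE.
- by apply: trunc_ge_exact => //; lia.
Qed.

Lemma trunc_ge_resolves_start :
  exists eps' : {linear trunc_ge s s -> N}, resolves eps' /\
    forall x, eps' x = eps (keep_out _ _ x).
Proof.
have [_ Cs Cex] := rC.
have lin : linear (fun x : trunc_ge s s => eps (keep_out (s <= s)%R (C s) x)).
  by move=> a x y; rewrite !linearP.
exists (mklin lin); split=> //; split=> [i x lt|x|i j l' x ij jl tj].
- by apply: keep0; rewrite -ltNge.
- rewrite [mklin lin x](_ : _ = eps (keep_out _ _ x)) //.
  split=> [/Cs[y yE]|[y <-]].
    exists (keep_in _ _ y).
    by rewrite trunc_dE keep_inK ?yE ?keep_outK //; lia.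
  by rewrite trunc_dE keep_inK //; apply/Cs; eexists.
- by apply: trunc_ge_exact => //; lia.
Qed.

End TruncationResolves.

Section Cone.
Variables (R : comNzRingType) (C D : chain_complex R) (f : cocycle D C 1).

Definition cone_ghom :
  ghom (fun i => (C i * D i)%type) (fun i => (C i * D i)%type) 1.
Proof.
exists (fun i j (x : C i * D i) =>
  (ghom_app (cplx_d C) j x.1 + ghom_app (cycle_val f) j x.2,
   ghom_app (cplx_d D) j x.2)).
  move=> i j a x y /=; rewrite !linearP; congr pair => /=.
  by rewrite scalerDr addrACA.
by move=> i j x ne; rewrite !ghom_app0 // addr0.
Defined.

(* The mapping cone of f, regarded as a degree 0 map from the desuspension of
   D; it needs no shift because f has degree 1. *)
Definition cone : chain_complex R.
Proof.
exists (fun i => (C i * D i)%type) cone_ghom.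
apply: ghomP => i j x; rewrite (ghom_compE _ _ _ _ _ (esym (subrK 1 i))).
congr pair; last exact: cplx_ddE.
rewrite /= linearD /=.
have := cocycle1_d f (i - 1) j x.2; rewrite -addrA => ->.
by rewrite addr0; apply: cplx_ddE.
Defined.

Lemma cone_dE i j (x : cone i) : ghom_app (cplx_d cone) j x =
  (ghom_app (cplx_d C) j x.1 + ghom_app (cycle_val f) j x.2,
   ghom_app (cplx_d D) j x.2) :> (C j * D j)%type.
Proof. by []. Qed.

Lemma cone_projective :
  projective_complex C -> projective_complex D -> projective_complex cone.
Proof. by move=> pC pD i; apply: lift_property_prod. Qed.

Fact pair0r_linear i : linear (fun a : C i => (a, 0) : cone i).
Proof.
move=> a u v; congr pair.
by rewrite [RHS](_ : _ = a *: 0 + 0) // scaler0 addr0.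
Qed.
Fact pair0l_linear i : linear (fun a : D i => (0, a) : cone i).
Proof.
move=> a u v; congr pair.
by rewrite [RHS](_ : _ = a *: 0 + 0) // scaler0 addr0.
Qed.
Fact fst_linear i : linear (fun x : cone i => x.1 : C i).
Proof. by []. Qed.
Fact snd_linear i : linear (fun x : cone i => x.2 : D i).
Proof. by []. Qed.

Lemma cone_inclusion : exists a : cocycle C cone 0,
  forall i (x : C i), ghom_app (cycle_val a) i x = (x, 0) :> (C i * D i)%type.
Proof.
have [|a aE] := @chain_map R C cone (fun i => mklin (@pair0r_linear i)).
  by move=> i x; rewrite cone_dE /= !linear0 addr0.
by exists a.
Qed.

Lemma cone_projection : exists a : cocycle cone D 0,
  forall i (x : cone i), ghom_app (cycle_val a) i x = x.2.
Proof.
have [//|a aE] := @chain_map R cone D (fun i => mklin (@snd_linear i)).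
by exists a.
Qed.

Lemma cone_minimal (k : fieldType) (pi : {rmorphism R -> k}) :
  minimal_complex pi C -> minimal_complex pi D ->
  (forall i j (x : D i),
    mmul pi (@all_elements R (C j)) (ghom_app (cycle_val f) j x)) ->
  minimal_complex pi cone.
Proof.
move=> mC mD mf i j x; rewrite cone_dE.
set u := (X in (X, _)); set v := (X in (_, X)).
have -> : (u, v) = mklin (@pair0r_linear j) u + mklin (@pair0l_linear j) v.
  by rewrite [RHS](_ : _ = (u + 0, 0 + v)) // addr0 add0r.
apply: mmulD; apply: (mmul_image (S := @all_elements R _)) => //.
  by apply: mmulD; [apply: mC|apply: mf].
exact: mD.
Qed.

End Cone.

(** * Linearity of syzygies *)

Lemma noetherian_field (k : fieldType) : noetherian k.
Proof.
move=> I [I0 _ IM].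
have [[c Ic c0]|none] := pselect (exists2 c, I c & c != 0).
  exists 1%N, (fun=> 1) => v; split=> [_|[d ->]].
    by exists (fun=> v); rewrite big_ord1 mulr1.
  rewrite big_ord1 mulr1 -[d _](mulfVK c0); exact: IM.
exists 0%N, (fun=> 1) => v; split=> [Iv|[d ->]]; last by rewrite big_ord0.
exists (fun=> 0); rewrite big_ord0; apply/eqP; apply: contrapT => /negP v0.
by apply: none; exists v.
Qed.

(** A field is local with the identity as residue map, so minimal generators of a subspace are
    linearly independent; their number is at most [n], with equality only for the whole space. *)
Lemma row_subspace (k : fieldType) n (P : 'rV[k]_n -> Prop) : submodule P ->
  exists r (B : 'M[k]_(r, n)), (forall c, P c <-> exists e, c = e *m B) /\
    ((r < n)%N \/ r = n /\ forall c, P c).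
Proof.
move=> sP.
have unitk (r : k) : (idfun : {rmorphism k -> k}) r <> 0 -> exists s, s * r = 1.
  by move=> /eqP r0; exists r^-1; rewrite mulVf.
have [r [b [bP bmin]]] :=
  minimal_generators unitk
    (finite_submodule (@noetherian_field k) (finite_module_row k n) sP).
pose B := \matrix_i b i.
have bE (w : 'rV_r) : w *m B = \sum_i w 0 i *: b i.
  by rewrite mulmx_sum_row; apply: eq_bigr => i _; rewrite rowK.
have PB c : P c <-> exists e, c = e *m B.
  split=> [/bP[d ->]|[e ->]]; last by apply/bP; exists (fun i => e 0 i).
  exists (\row_i d i); rewrite bE; apply: eq_bigr => i _.
  by rewrite mxE.
have fB : row_free B.
  apply: inj_row_free => w; rewrite bE => /bmin w0.
  by apply/rowP => i; rewrite mxE; apply: w0.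
exists r, B; split=> //.
have rB : \rank B = r by apply/eqP.
have := rank_leq_col B; rewrite rB leq_eqVlt => /orP[/eqP rn|]; last by left.
right; split=> // c; apply/PB.
have : (c <= B)%MS by apply: submx_full; rewrite /row_full rB rn.
by move=> /submxP[e ->]; exists e.
Qed.

Section ConcaGenerator.
Variables (R : comNzRingType) (k : fieldType) (pi : {rmorphism R -> k}).
Local Notation kR := (resmod pi).
Local Notation mmul := (mmul pi).
Local Notation all := (@all_elements R _).
Hypothesis nR : noetherian R.
Hypothesis pis : forall y : k, exists r : R, pi r = y.
Variable x : R.
Hypothesis x2 : x * x = 0.
Hypothesis xm : pi x = 0.
Hypothesis mx : forall a b, pi a = 0 -> pi b = 0 ->
  exists2 y, pi y = 0 & a * b = x * y.

(** Two uses of [mx] give [a * b * c = x * (y * c) = x * (x * z)], which [x2] kills. *)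
Lemma maximal_ideal_cube a b c :
  pi a = 0 -> pi b = 0 -> pi c = 0 -> a * b * c = 0.
Proof.
move=> a0 b0 c0; have [y y0 ->] := mx a0 b0.
rewrite -mulrA; have [z _ ->] := mx y0 c0.
by rewrite mulrA x2 mul0r.
Qed.

(** An inverse modulo m is corrected by the geometric series [1 + y + y * y], which stops there
    because m^3 = 0. *)
Lemma unit_residue r : pi r <> 0 -> exists s, s * r = 1.
Proof.
move=> /eqP r0; have [s sE] := pis (pi r)^-1.
have [y yE] : exists y, y = 1 - s * r by eexists.
have y0 : pi y = 0 by rewrite yE rmorphB rmorph1 rmorphM sE mulVf // subrr.
exists ((1 + y + y * y) * s); rewrite -mulrA.
have -> : s * r = 1 - y by rewrite yE opprB addrC subrK.
have y3 : y * y * y = 0 by apply: maximal_ideal_cube.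
rewrite mulrBr mulr1 !mulrDl mul1r y3 addr0.
by rewrite -[1 + y + y * y]addrA addrK.
Qed.

Lemma mmul_square (V : lmodType R) (v : V) :
  mmul (mmul all) v -> exists2 u, mmul all u & v = x *: u.
Proof.
elim=> [|u w _ [u' mu ->] _ [w' mw ->]|a w a0].
- by exists 0; [exact: mmul0|rewrite scaler0].
- by exists (u' + w'); [exact: mmulD|rewrite scalerDr].
elim=> [|u v' _ [u' mu uE] _ [w' mw wE]|b u b0 _].
- by exists 0; [exact: mmul0|rewrite !scaler0].
- by exists (u' + w'); [exact: mmulD|rewrite !scalerDr uE wE].
have [y y0 e] := mx a0 b0.
by exists (y *: u); [exact: mmulM|rewrite !scalerA e].
Qed.

Lemma mmul_cube (V : lmodType R) a (v : V) :
  pi a = 0 -> mmul (mmul all) v -> a *: v = 0.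
Proof.
move=> a0; elim=> [|u w _ u0 _ w0|b w b0].
- by rewrite scaler0.
- by rewrite scalerDr u0 w0 addr0.
elim=> [|u v' _ u0 _ w0|c u c0 _].
- by rewrite !scaler0.
- by rewrite !scalerDr u0 w0 addr0.
by rewrite !scalerA maximal_ideal_cube // scale0r.
Qed.

(* Passing from g V to ker g does not increase the number of generators of the
   defect m Z / x Z, as m^2 V = x m V and x^2 = 0. *)
Lemma defect_step (V W : lmodType R) (g : {linear V -> W}) (K : V -> Prop)
    n (w : 'I_n -> W) :
  (forall v, g v = 0 -> K v) ->
  (forall j, mmul (fun y => exists v, g v = y) (w j)) ->
  (forall v, mmul (fun y => exists v, g v = y) v ->
     exists c y, v = x *: g y + \sum_j c j *: w j) ->
  exists v : 'I_n -> V, (forall j, mmul (mmul all) (v j)) /\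
    forall u, mmul (mmul all) u ->
      exists c y, K y /\ u = x *: y + \sum_j c j *: v j.
Proof.
move=> gK mw wgen.
have lift y : mmul (fun y => exists v, g v = y) y ->
    exists2 v, mmul all v & g v = y.
  by apply: mmul_lift => z [v <-]; exists v.
have [l lE] : exists l : 'I_n -> V, forall j, mmul all (l j) /\ g (l j) = w j.
  apply: (fun_choice (P := fun j v => mmul all v /\ g v = w j)) => j.
  by have [v ? ?] := lift _ (mw j); exists v.
exists (fun j => x *: l j); split=> [j|u /mmul_square[u' mu' ->]].
  by apply: mmulM => //; have [] := lE j.
have [|c [y yE]] := wgen (g u').
  by apply: mmul_image mu' => v _; exists v.
(* This witness lies in [ker g] by the choice of [c] and [y]; after multiplication by [x] its term
   [x *: y] disappears. *)
exists c, (u' - x *: y - \sum_j c j *: l j); split.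
  apply: gK; rewrite !linearB linearZ_LR linear_sum yE.
  rewrite [X in _ - X](eq_bigr (fun j => c j *: w j)) => [|j _].
    by rewrite [x *: _ + _]addrC addrK subrr.
  by rewrite linearZ_LR (lE j).2.
rewrite !scalerBr scalerA x2 scale0r subr0 scaler_sumr.
rewrite [X in _ - X](eq_bigr (fun j => c j *: (x *: l j))) ?subrK // => j _.
by rewrite !scalerA mulrC.
Qed.

(** A dimension count modulo [U0]: [W] is killed by m, hence a vector space, and [U] is pulled back
    to a subspace of the coordinate space k^n of the [v j]. The last alternative, strict drop or [U]
    equal to [W], is what a minimal [n] exploits. *)
Lemma subspace_generators (V : lmodType R) (U0 U W : V -> Prop) n
    (v : 'I_n -> V) :
  submodule U -> (forall y, U0 y -> U y) ->
  (forall a w, pi a = 0 -> W w -> a *: w = 0) ->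
  (forall j, W (v j)) -> (forall w, U w -> W w) ->
  (forall w, W w -> exists c y, U0 y /\ w = y + \sum_j c j *: v j) ->
  exists r (u : 'I_r -> V), [/\ forall j, U (u j),
    forall w, U w -> exists c y, U0 y /\ w = y + \sum_j c j *: u j
    & (r < n)%N \/ r = n /\ forall w, W w -> U w].
Proof.
move=> sU U0U mW Wv UW gen.
have mod_m (c d : 'I_n -> R) : (forall j, pi (c j) = pi (d j)) ->
    \sum_j c j *: v j = \sum_j d j *: v j.
  move=> cd; apply: eq_bigr => j _; apply/eqP.
  by rewrite -subr_eq0 -scalerBl mW // rmorphB cd subrr.
have [l lE] := fun_choice pis.
pose P (c : 'rV[k]_n) := U (\sum_j l (c 0 j) *: v j).
have PE (c : 'I_n -> R) : P (\row_j pi (c j)) = U (\sum_j c j *: v j).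
  by rewrite /P (mod_m _ c) // => j; rewrite lE mxE.
have sP : submodule P.
  split.
    rewrite /P (mod_m _ (fun=> 0)) => [|j]; last by rewrite lE mxE rmorph0.
    by rewrite big1 => [|j _]; [case: sU|rewrite scale0r].
  move=> a c d Pc Pd.
  rewrite /P (mod_m _ (fun j => l a * l (c 0 j) + l (d 0 j))) => [|j]; last first.
    by rewrite !mxE rmorphD rmorphM !lE.
  under eq_bigr do rewrite scalerDl -scalerA.
  by rewrite big_split -scaler_sumr; apply: (sU.2).
have [r [B [PB rn]]] := row_subspace sP.
pose u i := \sum_j l (B i j) *: v j.
have uE (e : 'I_r -> R) (c : 'I_n -> R) :
    (\row_j pi (c j) = (\row_i pi (e i)) *m B) ->
    \sum_i e i *: u i = \sum_j c j *: v j.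
  move=> ce; rewrite /u; under eq_bigr do rewrite scaler_sumr.
  rewrite exchange_big /=.
  under eq_bigr do under eq_bigr do rewrite scalerA.
  under eq_bigr do rewrite -scaler_suml.
  apply: mod_m => j; have /rowP/(_ j) := ce; rewrite !mxE => ->.
  by rewrite rmorph_sum; apply: eq_bigr => i _; rewrite rmorphM lE mxE.
exists r, u; split=> [i|w Uw|].
- suff : P (row i B) by rewrite /P; under eq_bigr do rewrite mxE.
  by apply/PB; exists (delta_mx 0 i); rewrite rowE.
- have [c [y [y0 wE]]] := gen w (UW _ Uw).
  have /PB[e ce] : P (\row_j pi (c j)).
    rewrite PE; have -> : \sum_j c j *: v j = w - y by rewrite wE addrAC subrr add0r.
    by apply: submoduleB => //; apply: U0U.
  exists (fun i => l (e 0 i)), y; split=> //; rewrite (uE _ c) // ce.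
  by congr (_ *m _); apply/rowP => i; rewrite mxE lE.
- case: rn => [lt|[rn allP]]; [by left|right]; split=> // w Ww.
  have [c [y [y0 ->]]] := gen w Ww.
  by apply: submoduleD; [|exact: U0U|rewrite -PE].
Qed.

End ConcaGenerator.

(** * The cone attached to a Koszul module *)

Section KoszulModules.
Variables (R : comNzRingType) (k : fieldType) (pi : {rmorphism R -> k}).
Local Notation kR := (resmod pi).
Local Notation mmul := (mmul pi).
Local Notation all := (@all_elements R _).
Hypothesis nR : noetherian R.
Hypothesis pis : forall y : k, exists r : R, pi r = y.
Hypothesis unitR : forall r, pi r <> 0 -> exists s, s * r = 1.

Definition cplx_image (C : chain_complex R) i (v : C i) :=
  exists y : C (i + 1), ghom_app (cplx_d C) i y = v.

(* The part of C in degrees >= s is a linear minimal resolution: the syzygies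
   Z = cplx_image satisfy m Z = m^2 C. *)
Definition linear_from s (C : chain_complex R) :=
  forall i (v : C i), (s <= i)%R -> mmul (mmul all) v ->
    mmul (@cplx_image C i) v.

Section KoszulCone.
Variables (s : int) (C D : chain_complex R) (N : lmodType R) (r : nat).
Variables (eps : {linear C s -> N}).
Variables (eta : {linear D (s + 1) -> {ffun 'I_r -> kR}}).
Variable iota : {linear {ffun 'I_r -> kR} -> N}.
Variable f : cocycle D C 1.
Hypotheses (rC : resolves eps) (rD : resolves eta).
Hypothesis eta_surj : forall c, exists y, eta y = c.
Hypotheses (mC : minimal_complex pi C) (mD : minimal_complex pi D).
Hypothesis linC : linear_from s C.
Hypothesis iota_inj : injective iota.
Hypothesis iotaP : forall v, mmul (fun w => exists y, eps y = w) v <->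
  exists c, iota c = v.
Hypothesis fE : forall y : D (s + 1),
  eps (ghom_app (cycle_val f) s y) = iota (eta y).

(** By induction on the degree, each value is an element of m C up to a boundary, and boundaries lie
    in m C. At the start the augmented value lies in m K. Later d f y = - f d y lies in m^2 C by the
    previous degree, and linearity makes it d of an element of m C; the difference is a cycle, hence
    a boundary. *)
Lemma koszul_map_minimal i j (y : D i) :
  mmul all (ghom_app (cycle_val f) j y).
Proof.
have [D0 _ _] := rD; have [C0 Cs Cex] := rC.
have [ij|ne] := eqVneq i (j + 1); last by rewrite ghom_app0 //; apply: mmul0.
subst i; have [lt|ge] := ltP j s; first by rewrite [ghom_app _ _ _]C0 //; apply: mmul0.
have [n jn] : exists n, j = s + Posz n by exists (absz (j - s)); lia.
clear ge; subst j.
have split_mmul i (v : C i) (w : C i) : mmul all w -> @cplx_image C i (v - w) ->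
    mmul all v.
  move=> mw [z zE]; rewrite -[v](subrK w); apply: mmulD => //.
  by rewrite -zE; apply: mC.
elim: n y => [|n IHn] y.
  have e : s + Posz 0 = s by rewrite addr0.
  move: y; rewrite e => y.
  have : mmul (fun w => exists y, eps y = w) (eps (ghom_app (cycle_val f) s y)).
    by apply/iotaP; exists (eta y).
  have eim w : (exists y, eps y = w) -> exists2 v : C s, all v & eps v = w.
    by move=> [v <-]; exists v.
  move=> /(mmul_lift eim)[v mv vE]; apply: (split_mmul _ _ v mv).
  by apply/Cs; rewrite linearB /= vE subrr.
set j := s + Posz n in IHn.
have ej : s + Posz n.+1 = j + 1 by rewrite /j; lia.
move: y; rewrite ej => y.
have m2 : mmul (mmul all) (ghom_app (cplx_d C) j
    (ghom_app (cycle_val f) (j + 1) y)).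
  have /eqP := cocycle1_d f (j + 1) j y; rewrite addr_eq0 => /eqP ->.
  rewrite -scaleN1r; apply: mmulZ.
  have lin : linear (fun u : D (j + 1) => ghom_app (cycle_val f) j u).
    by move=> a u v; rewrite linearP.
  apply: (mmul_image (f := mklin lin) (S := all)) (mD _ _) => w _.
  exact: IHn.
have sj : (s <= j)%R by rewrite /j; lia.
have eim w : @cplx_image C j w ->
    exists2 v : C (j + 1), all v & ghom_app (cplx_d C) j v = w.
  by move=> [v <-]; exists v.
have [v mv vE] := mmul_lift (f := mklin (fun a => linearP (ghom_app (cplx_d C) j) a))
  eim (linC sj m2).
apply: (split_mmul _ _ v mv).
apply: (Cex _ _ j) => //; first by lia.
by rewrite linearB /=; have /= -> := vE; rewrite subrr.
Qed.

(** [f] lifts the inclusion of m K into the image K of [eps], so the cone resolves K / m K; this is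
    [C s] modulo m, since minimality puts the kernel of [eps] inside m C. *)
Lemma koszul_cone_resolves n (q : {linear C s -> {ffun 'I_n -> kR}}) :
  (forall v, q v = 0 <-> mmul all v) ->
  exists epsK : {linear cone f s -> {ffun 'I_n -> kR}}, resolves epsK /\
    forall v, epsK v = q v.1.
Proof.
move=> qE; have [D0 Ds Dex] := rD; have [C0 Cs Cex] := rC.
have lin : linear (fun v : cone f s => q v.1).
  by move=> a u v /=; rewrite linearP.
exists (mklin lin); split=> //; split.
- move=> i [a b] lt.
  have -> : a = 0 by apply: C0.
  by have -> : b = 0 by apply: D0; lia.
- move=> [a b] /=; split=> [/qE ma|[[a' b']]].
    have : mmul (fun w => exists y, eps y = w) (eps a).
      by apply: mmul_image ma => w _; exists w.
    move=> /iotaP[c cE]; have [b' b'E] := eta_surj c.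
    have /Cs[a' a'E] : eps (a - ghom_app (cycle_val f) s b') = 0.
      by rewrite linearB fE b'E cE subrr.
    exists (a', b'); rewrite cone_dE /= a'E subrK; congr pair.
    by rewrite [LHS]D0 ?[RHS]D0 //; lia.
  rewrite cone_dE => -[<- _]; apply/qE; apply: mmulD; first exact: mC.
  exact: koszul_map_minimal.
- move=> i j l [a b] ij jl sj; rewrite cone_dE /= => -[da db].
  have [b' b'E] : exists b' : D i, ghom_app (cplx_d D) j b' = b.
    (* In degree [s + 1] exactness of [D] goes through [eta]: the cycle condition gives eps (f b) =
       - eps (d a) = 0, and injectivity of [iota] turns this into eta b = 0. *)
    have [js|js] := eqVneq j (s + 1); last by apply: (Dex _ _ l) => //; lia.
    have ls : l = s by lia.
    move=> {Dex jl sj}; subst l; subst j; subst i.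
    apply/Ds; apply: iota_inj; rewrite linear0 -fE.
      move/eqP: da; rewrite addr_eq0 => /eqP/(congr1 eps).
      rewrite linearN (_ : eps _ = 0); last by apply/Cs; exists a.
      by move=> /esym/eqP; rewrite oppr_eq0 => /eqP.
  have [a' a'E] : exists a' : C i, ghom_app (cplx_d C) j a' =
      a - ghom_app (cycle_val f) j b'.
    apply: (Cex _ _ l) => //; rewrite linearB /=.
    have /eqP := cocycle1_d f j l b'; rewrite addr_eq0 => /eqP->.
    by rewrite opprK b'E.
  by exists (a', b'); rewrite cone_dE /= a'E b'E subrK.
Qed.

End KoszulCone.
End KoszulModules.

(** * Free dimension of Ext *)

Section ExtDimension.
Variables (R : comNzRingType) (k : fieldType) (pi : {rmorphism R -> k}).
Local Notation kR := (resmod pi).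
Local Notation mmul := (mmul pi).
Local Notation all := (@all_elements R _).
Hypothesis nR : noetherian R.
Hypothesis pis : forall y : k, exists r : R, pi r = y.
Hypothesis unitR : forall r, pi r <> 0 -> exists s, s * r = 1.
Variables (G : chain_complex R) (epsG : {linear G 0 -> kR}).
Hypotheses (pG : projective_complex G) (rG : resolves epsG).
Hypothesis sG : forall y, exists x, epsG x = y.
Local Notation Ext C := (Ext_module C G).

Lemma finite_residue_power r : finite_module ({ffun 'I_r -> kR} : lmodType R).
Proof.
have [l lE] := fun_choice pis.
exists r, (fun i => [ffun j => if j == i then 1 else 0 : kR]) => y.
exists (fun i => l (y i)); apply/ffunP => j.
rewrite sum_ffunE (bigD1 j) //= big1 => [|i ij]; rewrite !ffunE.
  by rewrite eqxx addr0 [RHS](_ : _ = pi (l (y j)) * 1) // mulr1 lE.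
rewrite eq_sym (negbTE ij).
by rewrite scaler0.
Qed.

(** [sec] and [ret] split the sequence in each degree and need not commute with the differentials,
    because exactness is tested on components. *)
Lemma ext_split_exact (C C' C'' : chain_complex R) (a : cocycle C C' 0)
    (b : cocycle C' C'' 0) (sec : forall n, {linear C'' n -> C' n})
    (ret : forall n, {linear C' n -> C n}) :
  projective_complex C -> projective_complex C' -> projective_complex C'' ->
  minimal_complex pi C -> minimal_complex pi C' -> minimal_complex pi C'' ->
  (forall n (y : C n), ghom_app (cycle_val b) n (ghom_app (cycle_val a) n y) = 0) ->
  (forall n y, ghom_app (cycle_val b) n (sec n y) = y) ->
  (forall n y, ret n (ghom_app (cycle_val a) n y) = y) ->
  (forall n y, y = ghom_app (cycle_val a) n (ret n y) +
     sec n (ghom_app (cycle_val b) n y)) ->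
  short_exact (ext_map G (HomH_class b)) (ext_map G (HomH_class a)).
Proof.
move=> pC pC' pC'' mC mC' mC'' ba bs ra ars.
apply: (ext_short_exact rG sG pC pC' pC'') => //; try exact: minimal_residually.
- by move=> n phi phi0 v; rewrite -(bs n v) phi0.
- move=> n phi; split=> [phi0|[psi psiE] y]; last by rewrite psiE ba linear0.
  have lin : linear (fun v => phi (sec n v)) by move=> c u v; rewrite !linearP.
  exists (mklin lin) => y /=.
  by rewrite [in LHS](ars n y) linearD phi0 add0r.
- move=> n phi.
  have lin : linear (fun v => phi (ret n v)) by move=> c u v; rewrite !linearP.
  by exists (mklin lin) => y /=; rewrite ra.
Qed.

(** The last hypothesis says that m^2 K = 0 for the image K of [eps], which makes m K a power of
    k. *)
Lemma koszul_ext_dim s (C : chain_complex R) (N : lmodType R)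
    (eps : {linear C s -> N}) :
  projective_complex C -> minimal_complex pi C -> finite_complex C ->
  resolves eps -> linear_from pi s C -> finite_module N ->
  (forall a b w, pi a = 0 -> pi b = 0 -> a *: (b *: eps w) = 0) ->
  free_dim_le 1 (Ext C).
Proof.
move=> pC mC fC rC lC fN m2.
have mS a w : pi a = 0 -> mmul (fun w => exists y, eps y = w) w -> a *: w = 0.
  move=> a0; elim=> [|u v _ u0 _ v0|b u b0 [v <-]]; first by rewrite scaler0.
    by rewrite scalerDr u0 v0 addr0.
  exact: m2.
have [r [iota [iota_inj iotaP]]] := residue_embedding pis unitR
  (finite_submodule nR fN (submodule_mmul pi (fun w => exists y, eps y = w))) mS.
(* Starting [D] in degree [s + 1] and giving [f] degree 1 carries the shift in the exact
   sequence. *)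
have [D [eta [pD rD sD mD fD]]] :=
  minimal_resolution nR unitR (s + 1) (finite_residue_power r).
have lin : linear (fun y : D (s + 1) => iota (eta y)).
  by move=> a u v; rewrite !linearP.
have [||x [f [_ fE]]] := represents_lift (n := 1) (phi := mklin lin) pD rC erefl.
- move=> y /=; have : exists c, iota c = iota (eta y) by exists (eta y).
  move=> /iotaP; elim=> [|u v _ [y1 <-] _ [y2 <-]|a w _ [y1 <-]].
  + by exists 0; rewrite linear0.
  + by exists (y1 + y2); rewrite linearD.
  + by exists (a *: y1); rewrite linearZ_LR.
- by move=> y /=; rewrite (resolves_d rD) linear0.
have [n [q [qs qE]]] := residue_quotient nR pis unitR (fC s).
have fE' y : eps (ghom_app (cycle_val f) s y) = iota (eta y) by rewrite -fE.
have [epsK [rK epsKE]] :=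
  koszul_cone_resolves rC rD sD mC mD lC iota_inj iotaP fE' qE.
have mf := koszul_map_minimal rC rD mC mD lC iotaP fE'.
have sK y : exists v, epsK v = y.
  by have [v <-] := qs y; exists (v, 0); rewrite epsKE.
have pK := cone_projective (f := f) pC pD.
have mK := cone_minimal mC mD mf.
have [a aE] := cone_inclusion f; have [b bE] := cone_projection f.
apply: (@free_dim_le_short_exact _ _ 0 _ _ _ (ext_map G (HomH_class b))
  (ext_map G (HomH_class a))).
- apply: (ext_split_exact (sec := fun n => mklin (@pair0l_linear _ _ _ f n))
    (ret := fun n => mklin (@fst_linear _ _ _ f n))) => //.
  + by move=> i y; apply: (etrans (bE _ _)); rewrite aE.
  + by move=> i y; apply: (etrans (congr1 fst (aE i y))).
  + move=> i y; apply/esym.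
    apply: (etrans (congr2 +%R (aE i _)
      (congr1 (mklin (@pair0l_linear _ _ _ f i)) (bE i y)))).
    case: y => u v.
    by rewrite [LHS](_ : _ = (u + 0, 0 + v)) // addr0 add0r.
- exact: (ext_fin_free pG rG sG pK rK sK).
- exact: (ext_fin_free pG rG sG pD rD sD).
Qed.

(** For projective [C], its Ext is Hom(C_t, k) in the single degree [t]. *)
Definition trunc_at t (C : chain_complex R) := trunc (fun i => i == t) C.

Lemma trunc_at_dE t (C : chain_complex R) i j (y : trunc_at t C i) :
  ghom_app (cplx_d (trunc_at t C)) j y = 0.
Proof.
case: (orP (orbN (i == t))) => it; last by rewrite (keep0 y it) linear0.
case: (orP (orbN (j == t))) => jt; last exact: (keep0 (b := j == t)).
by rewrite ghom_app0 //; lia.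
Qed.

Lemma trunc_ge_projection t (C : chain_complex R) :
  exists b : cocycle (trunc_ge C t) (trunc_ge C (t + 1)) 0,
  forall i (x : trunc_ge C t i), ghom_app (cycle_val b) i x =
    keep_in (t + 1 <= i)%R _ (keep_out (t <= i)%R _ x).
Proof.
have lin i : linear (fun x : trunc_ge C t i =>
    keep_in (t + 1 <= i)%R _ (keep_out (t <= i)%R (C i) x) : trunc_ge C (t + 1) i).
  by move=> a x y; rewrite !linearP.
have [|b bE] := @chain_map R _ _ (fun i => mklin (@lin i)); last by exists b.
move=> i x.
case: (orP (orbN (t + 1 <= i)%R)) => ti; last first.
  by rewrite [LHS](keep0 _ ti) [RHS](keep0 _ ti).
rewrite [mklin _ _](_ : _ = keep_in (t + 1 <= i + 1)%R _
  (keep_out (t <= i + 1)%R _ x)) //.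
rewrite [RHS](_ : _ = keep_in (t + 1 <= i)%R _
  (keep_out (t <= i)%R _ (ghom_app (cplx_d (trunc_ge C t)) i x))) //.
by rewrite !trunc_dE !keep_inK //; lia.
Qed.

(** No compatibility with the differentials is asked of [h]: the only condition is in degree
    [t - 1], where the target is zero. *)
Lemma trunc_at_inclusion t (C D : chain_complex R) (h : {linear C t -> D t}) :
  exists a : cocycle (trunc_at t C) (trunc_ge D t) 0,
  forall i (x : trunc_at t C i), ghom_app (cycle_val a) i x =
    keep_in (t <= i)%R _ (ghom_app (ghom_single (esym (addr0 t)) h) i
      (keep_out (i == t) _ x)).
Proof.
have lin i : linear (fun x : trunc_at t C i => keep_in (t <= i)%R _
    (ghom_app (ghom_single (esym (addr0 t)) h) i (keep_out (i == t) _ x))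
      : trunc_ge D t i).
  by move=> a x y; rewrite !linearP.
have [|b bE] := @chain_map R _ _ (fun i => mklin (@lin i)); last by exists b.
move=> i x; rewrite trunc_at_dE linear0.
case: (orP (orbN (i + 1 == t))) => it; last by rewrite (keep0 x it) !linear0.
by apply: (keep0 (b := (t <= i)%R)); rewrite -ltNge; lia.
Qed.

End ExtDimension.

(** * Linear resolutions and Ext in the presence of a Conca generator *)

Section ConcaExt.
Variables (R : comNzRingType) (k : fieldType) (pi : {rmorphism R -> k}).
Local Notation kR := (resmod pi).
Local Notation mmul := (mmul pi).
Local Notation all := (@all_elements R _).
Hypothesis nR : noetherian R.
Hypothesis pis : forall y : k, exists r : R, pi r = y.
Variable x : R.
Hypothesis x2 : x * x = 0.
Hypothesis xm : pi x = 0.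
Hypothesis mx : forall a b, pi a = 0 -> pi b = 0 ->
  exists2 y, pi y = 0 & a * b = x * y.
Let unitR : forall r, pi r <> 0 -> exists s, s * r = 1 := unit_residue pis x2 mx.

Lemma linear_factor (A B W : lmodType R) (q : {linear A -> B})
    (phi : {linear A -> W}) :
  (forall y, exists v, q v = y) -> (forall v, q v = 0 -> phi v = 0) ->
  exists chi : {linear B -> W}, forall v, chi (q v) = phi v.
Proof.
move=> /fun_choice[g gE] q0.
have qphi v w : q v = q w -> phi v = phi w.
  by move=> e; apply/eqP; rewrite -subr_eq0 -linearB q0 // linearB e subrr.
have lin : linear (fun y => phi (g y)).
  by move=> a u v; rewrite -linearP; apply: qphi; rewrite linearP !gE.
by exists (mklin lin) => v /=; apply: qphi.
Qed.

Lemma mmul_image_square (C : chain_complex R) i (v : C i) :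
  minimal_complex pi C -> mmul (@cplx_image R C i) v -> mmul (mmul all) v.
Proof. by move=> mC; apply: mmul_mono => _ [y <-]; apply: mC. Qed.

Lemma kernel_image (C : chain_complex R) s (N : lmodType R)
    (eps : {linear C s -> N}) i (v : C (i + 1)) :
  resolves eps -> (s <= i)%R -> ghom_app (cplx_d C) i v = 0 ->
  cplx_image v.
Proof. by move=> [_ _ ex] si; apply: ex => //; lia. Qed.

Definition cplx_dlin (C : chain_complex R) i : {linear C (i + 1) -> C i} :=
  mklin (fun a => linearP (@ghom_app R C C 1 (cplx_d C) (i + 1) i) a).

(** Over k^n there is no defect from the start: [ker eps] contains m C_s, so m^2 C_s = x m C_s lies
    in x times the syzygy. This inclusion, stronger than linearity, is what [defect_step] passes on
    with an empty list of generators. *)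
Lemma residue_linear (C : chain_complex R) s n
    (eps : {linear C s -> {ffun 'I_n -> kR}}) :
  resolves eps -> minimal_complex pi C -> linear_from pi s C.
Proof.
move=> rC mC i v si.
suff strong : forall u : C i, mmul (mmul all) u ->
    exists2 y, cplx_image y & u = x *: y.
  by move=> /strong[y Zy ->]; apply: mmulM.
have [l ->] : exists l, i = s + Posz l by exists (absz (i - s)); lia.
clear i v si; elim: l => [|l IHl].
  rewrite addr0 => u /(mmul_square mx)[w mw ->]; exists w => //.
  by have [_ Cs _] := rC; apply/Cs; apply: linear_form_residue mw.
set i := s + Posz l in IHl.
have -> : s + Posz l.+1 = i + 1 by rewrite /i; lia.
have si : (s <= i)%R by rewrite /i; lia.
have [|||u [_ uE]] := @defect_step R k pi x x2 xm mx _ _ (cplx_dlin C i)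
  (@cplx_image R C (i + 1)) 0 (fun=> 0).
- by move=> w; apply: (kernel_image rC).
- by case.
- move=> w mw; have [|y [z <-] ->] := IHl w.
    by apply: mmul_image_square mC _.
  by exists (fun=> 0), z; rewrite big_ord0 addr0.
- move=> w /uE[c [y [Zy ->]]]; exists y => //.
  by rewrite big_ord0 addr0.
Qed.

(** [n] is the least number found in any degree, so it cannot drop after a degree [i0] that attains
    it, and the alternative of [subspace_generators] leaves m Z = m^2 C in every later degree. *)
Lemma linear_eventually (C : chain_complex R) (N : lmodType R)
    (eps : {linear C 0 -> N}) :
  resolves eps -> minimal_complex pi C -> finite_complex C ->
  exists2 s : int, (0 < s)%R & linear_from pi s C.
Proof.
move=> rC mC fC.
pose defect (i : int) n := exists w : 'I_n -> C i,
  (forall j, mmul (@cplx_image R C i) (w j)) /\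
  forall v, mmul (@cplx_image R C i) v -> exists c y,
    cplx_image y /\ v = x *: y + \sum_j c j *: w j.
pose P n := `[< exists2 i : int, (0 <= i)%R & defect i n >].
have exP : exists n, P n.
  have [n [b bM]] := finite_submodule nR (fC 0)
    (submodule_mmul pi (@cplx_image R C 0)).
  exists n; apply/asboolP; exists 0 => //; exists b; split=> [j|v /bM[c ->]].
    exact: generated_mem bM.
  exists c, 0; split; first by exists 0; rewrite linear0.
  by rewrite scaler0 add0r.
case: (ex_minnP exP) => n /asboolP[i0 i00 def0] nmin.
have step (i : int) : (0 <= i)%R -> defect i n -> defect (i + 1) n /\
    forall v : C (i + 1), mmul (mmul all) v -> mmul (@cplx_image R C (i + 1)) v.
  move=> i0' [w [mw wE]].
  have [|||v [mv vE]] := @defect_step R k pi x x2 xm mx _ _ (cplx_dlin C i)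
    (@cplx_image R C (i + 1)) n w.
  - by move=> u; apply: (kernel_image rC).
  - exact: mw.
  - by move=> u /wE[c [_ [[y <-] ->]]]; exists c, y.
  (* Here [U0] is x Z, [U] is m Z and [W] is m^2 C, all in [C (i + 1)]. *)
  have [||||||r [u [mu uE rn]]] := @subspace_generators R k pi pis _
    (fun y => exists2 z, @cplx_image R C (i + 1) z & y = x *: z)
    (mmul (@cplx_image R C (i + 1))) (mmul (mmul all)) n v.
  - exact: submodule_mmul.
  - by move=> _ [z Zz ->]; apply: mmulM.
  - by move=> a y; apply: (mmul_cube x2 mx).
  - exact: mv.
  - by move=> y; apply: mmul_image_square.
  - by move=> y /vE[c [z [Zz ->]]]; exists c, (x *: z); split=> //; exists z.
  have defr : defect (i + 1) r.
    exists u; split=> // y /uE[c [_ [[z Zz ->] ->]]].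
    by exists c, z.
  have /nmin nr : P r by apply/asboolP; exists (i + 1) => //; lia.
  case: rn => [|[rn WU]]; first by rewrite ltnNge nr.
  by split; [rewrite -rn|].
(* Linearity begins one degree after the minimum is reached; this also makes [s] positive, so that
   the truncation at [s] resolves a syzygy inside [C (s - 1)]. *)
exists (i0 + 1); first by lia.
have def l : defect (i0 + Posz l) n.
  elim: l => [|l IHl]; first by rewrite addr0.
  have -> : i0 + Posz l.+1 = i0 + Posz l + 1 by lia.
  have i0l : (0 <= i0 + Posz l)%R by lia.
  by have [] := step _ i0l IHl.
move=> i v si.
have [l il] : exists l, i = i0 + Posz l + 1 by exists (absz (i - i0 - 1)%R); lia.
have i0l : (0 <= i0 + Posz l)%R by lia.
by subst i; apply: (step _ i0l (def l)).2.
Qed.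

Lemma linear_trunc_ge s (C : chain_complex R) :
  linear_from pi s C -> linear_from pi s (trunc_ge C s).
Proof.
move=> lC i v si mv.
rewrite -(keep_outK v).
apply: (mmul_image (f := keep_in (s <= i)%R (C i))) (lC i _ si _).
  move=> _ [y <-]; exists (keep_in (s <= i + 1)%R _ y).
  by rewrite trunc_dE keep_inK //; lia.
apply: (mmul_image (f := keep_out (s <= i)%R (C i))) mv => w mw.
exact: (mmul_image (f := keep_out (s <= i)%R (C i))) mw.
Qed.

(** A boundary lies in m C and m^3 = 0, so syzygies are killed by m^2. *)
Lemma square_boundary (C : chain_complex R) i j (v : C i) a b :
  minimal_complex pi C -> pi a = 0 -> pi b = 0 ->
  a *: (b *: ghom_app (cplx_d C) j v) = 0.
Proof.
by move=> mC a0 b0; apply: (mmul_cube x2 mx) => //; apply: mmulM.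
Qed.

Variables (G : chain_complex R) (epsG : {linear G 0 -> kR}).
Hypotheses (pG : projective_complex G) (rG : resolves epsG).
Hypothesis sG : forall y, exists x, epsG x = y.
Local Notation Ext C := (Ext_module C G).

Lemma ext_trunc_ge_dim1 (C : chain_complex R) s0 s (N : lmodType R)
    (eps : {linear C s0 -> N}) :
  projective_complex C -> minimal_complex pi C -> finite_complex C ->
  resolves eps -> (s0 < s)%R -> linear_from pi s C ->
  free_dim_le 1 (Ext (trunc_ge C s)).
Proof.
move=> pC mC fC rC s0s lC.
have [e [re eE]] := trunc_ge_resolves rC (esym (subrK 1 s)) s0s.
apply: (koszul_ext_dim nR pis unitR pG rG sG (eps := e)) => //.
- exact: trunc_projective.
- exact: trunc_minimal.
- exact: trunc_finite.
- exact: linear_trunc_ge.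
- by move=> a b w a0 b0; rewrite eE; apply: square_boundary.
Qed.

(** Let [H] be a minimal resolution of C_t / m C_t = k^n starting in degree [t]. Its Ext is free and
    agrees with Hom(C_t, k) in degree [t]; the rest is Ext of the truncation of [H] above [t], which
    resolves a Koszul syzygy and has dimension at most 1. *)
Lemma ext_trunc_at_dim t (C : chain_complex R) :
  projective_complex C -> minimal_complex pi C -> finite_complex C ->
  free_dim_le 2 (Ext (trunc_at t C)).
Proof.
move=> pC mC fC.
have [n [q [qs qE]]] := residue_quotient nR pis unitR (fC t).
have [H [epsH [pH rH sH mH fH]]] :=
  minimal_resolution nR unitR t (finite_residue_power pis n).
have [h hE] := pC t _ _ epsH q (fun v => sH (q v)).
have [eps' [r' eps'E]] := trunc_ge_resolves_start rH.
have s' y : exists v, eps' v = y.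
  by have [v <-] := sH y; exists (keep_in _ _ v); rewrite eps'E keep_inK.
have fH' : fin_free (Ext (trunc_ge H t)).
  exact: (ext_fin_free pG rG sG (trunc_projective pH) r' s').
have dH' : free_dim_le 1 (Ext (trunc_ge H (t + 1))).
  apply: (ext_trunc_ge_dim1 pH mH fH rH); first by lia.
  by move=> i v ti; apply: (residue_linear rH mH); lia.
have [a aE] := trunc_at_inclusion h; have [b bE] := trunc_ge_projection t H.
have epsHE v : mmul all v <-> epsH v = 0.
  split; first exact: linear_form_residue.
  by have [_ Hs _] := rH; move=> /Hs[y <-]; apply: mH.
apply: (@free_dim_le_short_exact _ _ 1 _ _ _ (ext_map G (HomH_class b))
  (ext_map G (HomH_class a))) => //.
have aE' (y : C t) : ghom_app (cycle_val a) t (keep_in (t == t) _ y) =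
    keep_in (t <= t)%R _ (h y).
  by rewrite aE keep_inK // ghom_singleE.
have aE0 i (y : trunc_at t C i) : i != t -> y = 0.
  by move=> it; apply: (keep0 (b := i == t)).
have bE0 i (y : trunc_ge H (t + 1) i) : (i <= t)%R -> y = 0.
  by move=> it; apply: (keep0 (b := (t + 1 <= i)%R)); rewrite -ltNge; lia.
(* [h] is known to be bijective only modulo m, so no degreewise splitting is at hand. *)
apply: (ext_short_exact rG sG);
  try by [apply: trunc_projective|apply/minimal_residually/trunc_minimal].
- move=> i phi phi0 v; rewrite -(keep_outK v).
  rewrite -[RHS](phi0 (keep_in (t <= i)%R _ (keep_out (t + 1 <= i)%R _ v))) bE.
  case: (orP (orbN (t + 1 <= i)%R)) => ti; first by rewrite !keep_inK //; lia.
  by rewrite [X in phi X](keep0 _ ti) [X in _ = phi X](keep0 _ ti).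
- move=> i phi.
  have lin : linear (fun v : trunc_ge H (t + 1) i =>
      phi (keep_in (t <= i)%R _ (keep_out (t + 1 <= i)%R _ v))).
    by move=> c u v; rewrite !linearP.
  split=> [phi0|[psi psiE] y].
    exists (mklin lin) => y.
    rewrite bE [RHS](_ : _ = phi (keep_in (t <= i)%R _ (keep_out (t + 1 <= i)%R _
      (keep_in (t + 1 <= i)%R _ (keep_out (t <= i)%R _ y))))) //.
    case: (orP (orbN (t + 1 <= i)%R)) => ti.
      by rewrite (keep_inK ti) keep_outK.
    rewrite [X in keep_out _ _ X](keep0 _ ti) !linear0.
    case: (orP (orbN (t <= i)%R)) => ti'; last by rewrite (keep0 y ti') linear0.
    have it : i = t by lia.
    subst i; rewrite -(keep_outK y); set u := keep_out _ _ y.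
    have lin' : linear (fun w : H t => phi (keep_in (t <= t)%R _ w)).
      by move=> c w w'; rewrite !linearP.
    (* [u] and [h v] have the same residue, so they differ by an element of m H, which [phi]
       kills. *)
    have [v vE] := qs (epsH u).
    have mu : mmul all (u - h v) by apply/epsHE; rewrite linearB hE vE subrr.
    have := linear_form_residue1 (mklin lin') mu; rewrite linearB.
    move=> /eqP; rewrite subr_eq0 => /eqP e; apply: (etrans e).
    rewrite [LHS](_ : _ = phi (keep_in (t <= t)%R _ (h v))) //.
    by rewrite -aE' phi0.
  rewrite psiE; case: (orP (orbN (i == t))) => it.
    by rewrite [X in psi X]bE0 ?linear0 //; lia.
  by rewrite (keep0 y it) !linear0.
- move=> i phi; case: (orP (orbN (i == t))) => it; last first.
    have lin0 : linear (fun _ : trunc_ge H t i => 0 : kR).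
      by move=> c u v; rewrite scaler0 addr0.
    by exists (mklin lin0) => y; rewrite (keep0 y it) linear0.
  move/eqP: it => it; subst i.
  have lin : linear (fun v : C t => phi (keep_in (t == t) _ v)).
    by move=> c w w'; rewrite !linearP.
  (* [phi] kills m C_t, so it factors through [q], and [epsH] carries the factor over to [H t]. *)
  have [v|chi chiE] := linear_factor (phi := mklin lin) qs.
    by move=> /qE; apply: linear_form_residue1.
  have lin' : linear (fun u : trunc_ge H t t => chi (epsH (keep_out (t <= t)%R _ u))).
    by move=> c w w'; rewrite !linearP.
  exists (mklin lin') => y; rewrite -(keep_outK y) aE'.
  rewrite [RHS](_ : _ = chi (epsH (keep_out (t <= t)%R _ (keep_in (t <= t)%R _
    (h (keep_out (t == t) _ y)))))) //.
  by rewrite keep_inK // hE chiE.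
Qed.

(** Descending induction from the Koszul truncation at [s] to degree 0: each component C_t put back
    extends the Ext module by one concentrated in degree t, and the horseshoe lemma keeps the bound
    2. *)
Lemma ext_resolution_dim (C : chain_complex R) (N : lmodType R)
    (eps : {linear C 0 -> N}) :
  projective_complex C -> minimal_complex pi C -> finite_complex C ->
  resolves eps -> free_dim_le 2 (Ext (trunc_ge C 0)).
Proof.
move=> pC mC fC rC.
have [s s0 lC] := linear_eventually rC mC fC.
have dim n : free_dim_le 2 (Ext (trunc_ge C (s - Posz n))).
  elim: n => [|n].
    by rewrite subr0; apply/free_dim_leS/(ext_trunc_ge_dim1 pC mC fC rC).
  set t := s - Posz n.+1; have -> : s - Posz n = t + 1 by rewrite /t; lia.
  have idlin : linear (fun v : C t => v) by [].
  have [a aE] := trunc_at_inclusion (mklin idlin).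
  have [b bE] := trunc_ge_projection t C.
  move=> dimt1.
  apply: (free_dim_le_extension (f := ext_map G (HomH_class b))
    (g := ext_map G (HomH_class a))) dimt1 (ext_trunc_at_dim t pC mC fC).
  have sec_lin i : linear (fun v : trunc_ge C (t + 1) i =>
      keep_in (t <= i)%R _ (keep_out (t + 1 <= i)%R _ v) : trunc_ge C t i).
    by move=> c u v; rewrite !linearP.
  have ret_lin i : linear (fun v : trunc_ge C t i =>
      keep_in (i == t) _ (keep_out (t <= i)%R _ v) : trunc_at t C i).
    by move=> c u v; rewrite !linearP.
  apply: (ext_split_exact rG sG (sec := fun i => mklin (@sec_lin i))
      (ret := fun i => mklin (@ret_lin i)));
    try by [apply: trunc_projective|apply: trunc_minimal].
  - move=> i y; case: (orP (orbN (i == t))) => it.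
      by apply: (keep0 (b := (t + 1 <= i)%R)); rewrite -ltNge; lia.
    by rewrite (keep0 y it) !linear0.
  - move=> i v; rewrite bE.
    case: (orP (orbN (t + 1 <= i)%R)) => ti; last first.
      by rewrite [LHS](keep0 _ ti) [RHS](keep0 _ ti).
    rewrite [mklin _ _](_ : _ = keep_in (t <= i)%R _ (keep_out (t + 1 <= i)%R _ v)) //.
    by rewrite keep_inK ?keep_outK //; lia.
  - move=> i y; case: (orP (orbN (i == t))) => it; last first.
      by rewrite [LHS](keep0 _ it) [RHS](keep0 _ it).
    move/eqP: it => it; subst i; rewrite aE.
    rewrite [LHS](_ : _ = keep_in (t == t) _ (keep_out (t <= t)%R _
      (keep_in (t <= t)%R _ (ghom_app (ghom_single (esym (addr0 t)) (mklin idlin)) t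
        (keep_out (t == t) _ y))))) //.
    by rewrite ghom_singleE keep_inK // keep_outK.
  - move=> i y; rewrite aE bE.
    rewrite [X in _ = _ + X](_ : _ = keep_in (t <= i)%R _ (keep_out (t + 1 <= i)%R _
      (keep_in (t + 1 <= i)%R _ (keep_out (t <= i)%R _ y)))) //.
    rewrite [mklin _ y](_ : _ = keep_in (i == t) _ (keep_out (t <= i)%R _ y)) //.
    case: (orP (orbN (t <= i)%R)) => ti; last first.
      by rewrite [LHS](keep0 _ ti) [RHS](keep0 _ ti).
    case: (orP (orbN (i == t))) => it.
      rewrite [X in keep_out (t + 1 <= i)%R _ X](keep0 (b := (t + 1 <= i)%R)); last by lia.
      rewrite !linear0 [RHS]addr0; move/eqP: it => it; subst i.
      by rewrite keep_inK // ghom_singleE keep_outK.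
    rewrite [X in keep_out (i == t) _ X](keep0 (b := i == t)) // !linear0 add0r.
    by rewrite keep_inK ?keep_outK //; lia.
by have := dim (absz s); have -> : s - Posz (absz s) = 0 by lia.
Qed.

End ConcaExt.

Lemma free_resolution_resolves (R : comNzRingType) (M : lmodType R)
    (F : free_resolution M) : resolves (s := 0) (@fres_aug R M F).
Proof.
split; [exact: fres_neg|exact: fres_exact0|].
move=> i j l v ij jl j0 dv; subst i; apply: fres_exact => //.
by have -> : j - 1 = l by lia.
Qed.

Theorem corollary2p6
  (R : comNzRingType) (m : set R) (k : fieldType) (pi : {rmorphism R -> k})
  (hR : local_ring m pi) (hm : exists x : R, conca_generator m x)
  (L : lmodType R) (hL : finite_module L)
  (F : free_resolution L) (G : free_resolution (resmod pi)) :
  has_finite_free_resolution (Ext_module F G) 2.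
Proof.
have [nR _ _ pis piE] := hR; have [x [mx _ x2 mm]] := hm.
have xx : x * x = 0 by rewrite -expr2.
have xm : pi x = 0 by apply/piE.
(* The equality m^2 = x m, read on a single product. *)
have xmm a b : pi a = 0 -> pi b = 0 -> exists2 y, pi y = 0 & a * b = x * y.
  move=> /piE ma /piE mb.
  have : ideal_mul m m (a * b).
    by exists 1%N, (fun=> a), (fun=> b); split=> //; rewrite big_ord1.
  by rewrite -mm => -[y /piE y0 <-]; exists y.
have pF : projective_complex F by move=> i; apply/free_lift_property/fres_free.
have pG : projective_complex G by move=> i; apply/free_lift_property/fres_free.
have rF := free_resolution_resolves F; have rG := free_resolution_resolves G.
have unitR := unit_residue pis xx xmm.
(* [F] may be neither minimal nor finite; its Ext is that of a minimal resolution of [L] by finite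
   modules. *)
have [C [eps [pC rC sC mC fC]]] := minimal_resolution nR unitR 0 hL.
have [eps' [rC' eps'E]] := trunc_ge_resolves_start rC.
have [|v|h hb] := ext_iso G pF (trunc_projective pC) rF rC'.
- move=> v; have [w wE] := sC (fres_aug F v).
  by exists (keep_in _ _ w); rewrite eps'E keep_inK.
- exact: fres_aug_surj.
apply: free_dim_le2_resolution; apply: (free_dim_le_iso hb).
exact: (ext_resolution_dim nR pis xx xm xmm pG rG (@fres_aug_surj _ _ G) pC mC fC rC).
Qed.
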